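(* Let $q\ge 4$ be a prime power, let $E$ be the set of points of $\mathbb{P}^2(\mathbb{F}_q)$, and let $M_q$ be the parity check matroid of the Veronese code $C_q$, with $N_i=\{X\subseteq E: n(X)=i\}$. Then: (1) The inclusion-minimal elements of $N_1$ are the complements of the point sets of the $\frac{q(q+1)(q^2+q+1)}{2}$ pairs of distinct lines and of the point sets of the $q^5-q^2$ irreducible conics. (2) The inclusion-minimal elements of $N_2$ are the $q^2(q^2+q+1)$ complements of sets consisting of the $q+1$ points of a line together with one point outside that line, and the $\frac{(q^2+q+1)q^2(q^2+q)(q-1)^2}{24}$ complements of sets of $4$ points no $3$ of which lie on a line. (3) The inclusion-minimal elements of $N_3$ are the $q^2+q+1$ complements of the $q+1$ points of a line, and the $\frac{(q^2+q+1)q^2(q^2+q)}{6}$ complements of sets of $3$ non-collinear points. (4) The inclusion-minimal elements of $N_4$ are the $\frac{(q^2+q+1)(q^2+q)}{2}$ complements of pairs of distinct points. (5) The inclusion-minimal elements of $N_5$ are the $q^2+q+1$ complements of single points. (6) The only element of $N_6$ is $E$.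
   Context: Let $q$ be a prime power. Fix an ordering of the $q^2+q+1$ points of $\mathbb{P}^2$ over $\mathbb{F}_q$ and a coordinate representative $(x,y,z)$ of each; identify the coordinate positions with the set $E$ of these points. The Veronese code $C_q$ is the linear $[q^2+q+1,6]_q$ code with generator matrix whose columns are $(x^2,xy,xz,y^2,yz,z^2)$ for the chosen representatives. The parity check matroid $M_q$ is the matroid on $E$ whose independent sets are the subsets $X$ such that the columns of a parity check matrix of $C_q$ indexed by $X$ are linearly independent over $\mathbb{F}_q$. For $X\subseteq E$, $r(X)$ is the maximum size of an independent subset of $X$ and $n(X)=|X|-r(X)$ is its nullity. Lines and conics are understood as their sets of $\mathbb{F}_q$-rational points in $\mathbb{P}^2(\mathbb{F}_q)$. *)

(* Defs.v *)
From HB Require Import structures.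
From mathcomp Require Import all_boot all_order all_algebra.
From mathcomp.multinomials Require Import mpoly.

Set Implicit Arguments.
Unset Strict Implicit.
Unset Printing Implicit Defensive.

Import GRing.Theory.
Local Open Scope ring_scope.

Record matroid (E : finType) := Matroid {
  indep :> pred {set E};
  _ : indep set0;
  _ : forall X Y : {set E}, X \subset Y -> indep Y -> indep X;
  _ : forall X Y : {set E}, indep X -> indep Y -> (#|X| < #|Y|)%N ->
        exists2 y, y \in Y :\: X & indep (y |: X)
}.

Section MatroidRank.
Variables (E : finType) (M : matroid E).

Definition rank (X : {set E}) : nat :=
  \max_(Y : {set E} | (Y \subset X) && indep M Y) #|Y|.

Definition nullity (X : {set E}) : nat := (#|X| - rank X)%N.

Definition nullity_class (i : nat) : {set {set E}} :=
  [set X | nullity X == i].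

Definition minimal_nullity (i : nat) (X : {set E}) : bool :=
  minset (mem (nullity_class i)) X.

End MatroidRank.

Section LinearMatroid.
Variables (F : fieldType) (vT : vectType F) (E : finType) (c : E -> vT).

Definition linear_indep (X : {set E}) : bool := free [seq c x | x in X].

Lemma linear_indep0 : linear_indep set0.
Proof. by rewrite /linear_indep /image_mem enum_set0 nil_free. Qed.

Lemma linear_indepS (X Y : {set E}) :
  X \subset Y -> linear_indep Y -> linear_indep X.
Proof.
move=> sXY; rewrite /linear_indep /image_mem.
have /perm_free -> : perm_eq [seq c x | x <- enum Y]
  ([seq c x | x <- enum X] ++ [seq c x | x <- enum (Y :\: X)]).
  rewrite -map_cat; apply: perm_map; apply: uniq_perm; rewrite ?enum_uniq //.
    rewrite cat_uniq !enum_uniq andbT /=; apply/hasPn=> x.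
    by rewrite !mem_enum inE => /andP[].
  move=> x; rewrite mem_cat !mem_enum inE.
  by case: (boolP (x \in X)) => //= /(subsetP sXY).
exact: catl_free.
Qed.

Lemma linear_indepU (X Y : {set E}) :
  linear_indep X -> linear_indep Y -> (#|X| < #|Y|)%N ->
  exists2 y, y \in Y :\: X & linear_indep (y |: X).
Proof.
rewrite /linear_indep /image_mem => fX fY ltXY.
have [y yY yX] : exists2 y, y \in Y & c y \notin <<[seq c x | x <- enum X]>>%VS.
  apply/exists_inP; apply: contraLR ltXY; rewrite negb_exists_in -leqNgt.
  move=> /forall_inP sYX.
  have /dimvS : (<<[seq c x | x <- enum Y]>> <= <<[seq c x | x <- enum X]>>)%VS.
    apply/span_subvP=> z /mapP[y]; rewrite mem_enum => /sYX.
    by rewrite negbK => yX ->.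
  by move: fX fY; rewrite /free => /eqP-> /eqP->; rewrite !size_map -!cardE.
have nyX : y \notin X.
  by apply: contra yX => yX; apply/memv_span/map_f; rewrite mem_enum.
exists y; first by rewrite inE nyX.
have /(perm_map c)/perm_free -> : perm_eq (enum (y |: X)) (y :: enum X).
  apply: uniq_perm; rewrite /= ?enum_uniq ?mem_enum ?nyX //.
  by move=> x; rewrite inE !mem_enum !inE.
by rewrite /= free_cons yX.
Qed.

Definition linear_matroid : matroid E :=
  Matroid linear_indep0 linear_indepS linear_indepU.

End LinearMatroid.

(* [H] generates the dual of the code spanned by the rows of [G]: its rows are
   linearly independent and the code is the kernel of [H]. *)
Definition parity_check_matrix (F : fieldType) (k m n : nat)
    (G : 'M[F]_(k, n)) (H : 'M[F]_(m, n)) : Prop :=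
  row_free H /\ forall c : 'rV[F]_n, (c <= G)%MS <-> H *m c^T = 0.

(* A point is a one-dimensional subspace of [F^3], as a set of vectors
   (the zero vector belongs to every point). *)
Definition is_point (F : finFieldType) : pred {set 'rV[F]_3} :=
  fun A => [exists v : 'rV[F]_3, (v != 0) && (A == [set a *: v | a : F])].

Definition point (F : finFieldType) : finType :=
  {A : {set 'rV[F]_3} | is_point A}.

Definition representatives (F : finFieldType) (rep : point F -> 'rV[F]_3) :=
  forall p : point F, rep p \in val p /\ rep p != 0.

(* The rational points of the curve [Q = 0]; only meant for homogeneous [Q]
   of positive degree. *)
Definition zeros (F : finFieldType) (Q : {mpoly F[3]}) : {set point F} :=
  [set p : point F | [forall (v : 'rV[F]_3 | v \in val p), Q.@[fun i => v 0 i] == 0]].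

Definition is_line (F : finFieldType) (L : {set point F}) : Prop :=
  exists l : {mpoly F[3]}, [/\ l \is 1.-homog, l != 0 & L = zeros l].

Definition collinear (F : finFieldType) (Z : {set point F}) : Prop :=
  exists2 L : {set point F}, is_line L & Z \subset L.

Definition irreducible_mpoly (K : fieldType) (n : nat) (P : {mpoly K[n]}) :=
  [/\ P != 0, P \isn't a GRing.unit &
      forall A B : {mpoly K[n]}, P = A * B ->
        A \is a GRing.unit \/ B \is a GRing.unit].

(* Irreducible over every extension of the base field. A form that is only
   irreducible over [F] may split into two conjugate lines. *)
Definition abs_irreducible (F : fieldType) (n : nat) (P : {mpoly F[n]}) :=
  forall (K : fieldType) (f : {rmorphism F -> K}),
    irreducible_mpoly (map_mpoly f P).

Definition is_irreducible_conic (F : finFieldType) (C : {set point F}) : Prop :=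
  exists Q : {mpoly F[3]}, [/\ Q \is 2.-homog, abs_irreducible Q & C = zeros Q].

Definition is_line_pair (F : finFieldType) (Z : {set point F}) : Prop :=
  exists L1 L2 : {set point F},
    [/\ is_line L1, is_line L2, L1 != L2 & Z = L1 :|: L2].

Definition is_line_plus_point (F : finFieldType) (Z : {set point F}) : Prop :=
  exists (L : {set point F}) (p : point F),
    [/\ is_line L, p \notin L & Z = p |: L].

Definition is_quadrangle (F : finFieldType) (Z : {set point F}) : Prop :=
  #|Z| = 4%N /\
  forall T : {set point F}, T \subset Z -> #|T| = 3%N -> ~ collinear T.

Definition is_triangle (F : finFieldType) (Z : {set point F}) : Prop :=
  #|Z| = 3%N /\ ~ collinear Z.

Definition veronese (F : fieldType) (v : 'rV[F]_3) : seq F :=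
  let x := v 0 0 in let y := v 0 1 in let z := v 0 2 in
  [:: x ^+ 2; x * y; x * z; y ^+ 2; y * z; z ^+ 2].

(* [pt] lists the points; [rep] chooses their coordinates. *)
Definition veronese_generator (F : finFieldType) (n : nat)
    (pt : 'I_n -> point F) (rep : point F -> 'rV[F]_3) : 'M[F]_(6, n) :=
  \matrix_(i < 6, j < n) (veronese (rep (pt j)))`_i.

(* The matroid of the columns of [H], moved from column positions to points by
   the numbering [pos]. *)
Definition column_matroid (F : finFieldType) (m n : nat)
    (H : 'M[F]_(m, n)) (pos : point F -> 'I_n) : matroid (point F) :=
  linear_matroid (fun p => col (pos p) H).

Definition has_card (T : finType) (P : T -> Prop) (N : nat) : Prop :=
  exists2 S : {set T}, (forall x, x \in S <-> P x) & #|S| = N.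

(* Main.v *)
Require Import Defs.
From HB Require Import structures.
From mathcomp Require Import all_boot all_order all_algebra.
From mathcomp.multinomials Require Import mpoly.
From mathcomp Require Import all_fingroup all_field.
From mathcomp Require Import ring zify.

(* The nullity of X is the dimension of the space of quadratic forms vanishing
   on Z, the complement of X, so the minimal X of nullity i are the complements
   of the sets Z that are cut out by quadrics ("flats") and on which an
   i-dimensional space of forms vanishes. Adding to a flat a point outside it
   lowers this dimension by exactly 1. Three collinear points of a flat force
   the whole line into it, and then the flat is a line, a line with a point, or
   two lines, each of them being cut out by products of linear forms; without
   three collinear points it is an arc, with at most 4 points or of dimension 1.
   In the last case it is a conic, and no extension of the field splits its
   form, since one of the two linear factors would vanish at three independent
   points. Conversely an absolutely irreducible conic has a rational point
   (Chevalley-Warning), is not a cone (a binary form splits over an algebraic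
   closure), and therefore has q + 1 >= 5 points, no three of them collinear.
   Arcs are counted by extending them point by point, and conics by counting
   the 5-arcs that they contain. *)

(** In matroid terms, n(X) is 6 minus the rank of Z in the dual matroid, the one of the generator
    columns, and the sets called flats are its flats. The dimension 6 is reached because no nonzero
    quadratic form vanishes on the whole plane. The bound q >= 4 comes from the conics: with five
    points an irreducible conic determines its form up to a scalar. With at most four points it
    would be a small arc, of dimension 6 - |Z| > 1. Two obstacles shape the proof. Characteristic 2
    is included, so nothing is ever halved and the bilinear form does not recover the quadratic one.
    The field is not closed, so a pair of conjugate lines is irreducible over F but has a single
    rational point; this is why the splitting of forms is studied over extensions. The divisors 24,
    6 and 2 in the numbers of arcs are 4!, 3! and 2!, the numbers of orders in which the points can
    be added. The number q^5 - q^2 is the number of 5-arcs divided by the binomial coefficient of q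
    + 1 over 5. *)

Set Implicit Arguments.
Unset Strict Implicit.
Unset Printing Implicit Defensive.

Import GRing.Theory.

(** * Linear and quadratic forms in three variables *)

Section Coordinates.
Variable K : fieldType.
Local Open Scope ring_scope.
Implicit Types (u v w m x : 'rV[K]_3) (a b : 'rV[K]_6).

Definition row3 (x y z : K) : 'rV[K]_3 := \row_(j < 3) [:: x; y; z]`_j.

Lemma row3E0 (x y z : K) : row3 x y z 0 0 = x. Proof. by rewrite mxE. Qed.
Lemma row3E1 (x y z : K) : row3 x y z 0 1 = y. Proof. by rewrite mxE. Qed.
Lemma row3E2 (x y z : K) : row3 x y z 0 2 = z. Proof. by rewrite mxE. Qed.
Definition row3E := (row3E0, row3E1, row3E2).

Lemma ord3_cases (P : 'I_3 -> Prop) : P 0 -> P 1 -> P 2 -> forall i, P i.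
Proof.
by move=> P0 P1 P2 [[|[|[|//]]] i3];
  [move: P0 | move: P1 | move: P2]; congr P; apply: val_inj.
Qed.

Lemma eq_row3 u v :
  u 0 0 = v 0 0 -> u 0 1 = v 0 1 -> u 0 2 = v 0 2 -> u = v.
Proof. by move=> e0 e1 e2; apply/rowP; apply: ord3_cases. Qed.

Definition dot w v : K := w 0 0 * v 0 0 + w 0 1 * v 0 1 + w 0 2 * v 0 2.

Definition cross u v : 'rV[K]_3 :=
  row3 (u 0 1 * v 0 2 - u 0 2 * v 0 1) (u 0 2 * v 0 0 - u 0 0 * v 0 2)
       (u 0 0 * v 0 1 - u 0 1 * v 0 0).

Definition det3 u v w : K := dot (cross u v) w.

Definition ev a v : K :=
  let x := v 0 0 in let y := v 0 1 in let z := v 0 2 in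
  a 0 0 * (x * x) + a 0 1 * (x * y) + a 0 2 * (x * z) +
  a 0 3 * (y * y) + a 0 4 * (y * z) + a 0 5 * (z * z).

(** The polarization of the form. Its diagonal terms are doubled, so that [ev_polar] holds in
    characteristic 2 as well, where [polarvv] says nothing about [ev a v]. *)
Definition polar a u v : K :=
  let x := u 0 0 in let y := u 0 1 in let z := u 0 2 in
  let x' := v 0 0 in let y' := v 0 1 in let z' := v 0 2 in
  a 0 0 * (x * x' *+ 2) + a 0 1 * (x * y' + x' * y) + a 0 2 * (x * z' + x' * z)
  + a 0 3 * (y * y' *+ 2) + a 0 4 * (y * z' + y' * z) + a 0 5 * (z * z' *+ 2).

Definition row6 (s : seq K) : 'rV[K]_6 := \row_(j < 6) s`_j.

Definition mul_lin w m : 'rV[K]_6 :=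
  row6 [:: w 0 0 * m 0 0; w 0 0 * m 0 1 + w 0 1 * m 0 0;
      w 0 0 * m 0 2 + w 0 2 * m 0 0; w 0 1 * m 0 1;
      w 0 1 * m 0 2 + w 0 2 * m 0 1; w 0 2 * m 0 2].

Lemma row6E s : [/\ row6 s 0 0 = s`_0, row6 s 0 1 = s`_1, row6 s 0 2 = s`_2,
   row6 s 0 3 = s`_3 & row6 s 0 4 = s`_4 /\ row6 s 0 5 = s`_5].
Proof. by rewrite !mxE. Qed.

Lemma ev_mul_lin w m v : ev (mul_lin w m) v = dot w v * dot m v.
Proof.
rewrite /ev /dot /mul_lin; set s := (X in row6 X).
by have [-> -> -> -> [-> ->]] := row6E s; rewrite /s /=; ring.
Qed.

Lemma evD a b v : ev (a + b) v = ev a v + ev b v.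
Proof. by rewrite /ev !mxE; ring. Qed.

Lemma evZ c a v : ev (c *: a) v = c * ev a v.
Proof. by rewrite /ev !mxE; ring. Qed.

Lemma evZr a c v : ev a (c *: v) = c ^+ 2 * ev a v.
Proof. by rewrite /ev !mxE; ring. Qed.

Lemma ev_polar a s t u v :
  ev a (s *: u + t *: v) = s ^+ 2 * ev a u + s * t * polar a u v + t ^+ 2 * ev a v.
Proof. by rewrite /ev /polar !mxE; ring. Qed.

Lemma polarD a u v w : polar a u (v + w) = polar a u v + polar a u w.
Proof. by rewrite /polar !mxE; ring. Qed.

Lemma polarZ a c u v : polar a u (c *: v) = c * polar a u v.
Proof. by rewrite /polar !mxE; ring. Qed.

Lemma polarvv a v : polar a v v = ev a v *+ 2.
Proof. by rewrite /polar /ev; ring. Qed.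

Lemma dotC w v : dot w v = dot v w.
Proof. by rewrite /dot; ring. Qed.

Lemma dotD w u v : dot w (u + v) = dot w u + dot w v.
Proof. by rewrite /dot !mxE; ring. Qed.

Lemma dotZ w c v : dot w (c *: v) = c * dot w v.
Proof. by rewrite /dot !mxE; ring. Qed.

Lemma dot0 w : dot w 0 = 0.
Proof. by rewrite /dot !mxE; ring. Qed.

Lemma crossZ c u v : cross u (c *: v) = c *: cross u v.
Proof. by apply: eq_row3; rewrite /cross !(row3E, mxE) /=; ring. Qed.

Lemma det3C12 u v w : det3 v u w = - det3 u v w.
Proof. by rewrite /det3 /dot /cross !row3E; ring. Qed.

Lemma det3C23 u v w : det3 u w v = - det3 u v w.
Proof. by rewrite /det3 /dot /cross !row3E; ring. Qed.

Lemma det3_rot u v w : det3 v w u = det3 u v w.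
Proof. by rewrite /det3 /dot /cross !row3E; ring. Qed.

Lemma det3uvu u v : det3 u v u = 0.
Proof. by rewrite /det3 /dot /cross !row3E; ring. Qed.

Lemma det3uvv u v : det3 u v v = 0.
Proof. by rewrite /det3 /dot /cross !row3E; ring. Qed.

Lemma det3D u v w x : det3 u v (w + x) = det3 u v w + det3 u v x.
Proof. exact: dotD. Qed.

Lemma det3Z u v c w : det3 u v (c *: w) = c * det3 u v w.
Proof. exact: dotZ. Qed.

(** Cramer's rule cleared of denominators. When the determinant is nonzero it expands [x] in the
    basis (u, v, w), with coordinates that are linear forms in [x]. *)
Lemma cramer3 u v w x :
  det3 u v w *: x = det3 v w x *: u + det3 w u x *: v + det3 u v x *: w.
Proof. by apply: eq_row3; rewrite /det3 /dot /cross !(mxE, row3E) /=; ring. Qed.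

Lemma neq0_row3 v : v != 0 -> [|| v 0 0 != 0, v 0 1 != 0 | v 0 2 != 0].
Proof.
apply: contraR; rewrite !negb_or !negbK => /and3P[/eqP e0 /eqP e1 /eqP e2].
by apply/eqP/eq_row3; rewrite mxE.
Qed.

Lemma dot_eq0 w : (forall v, dot w v = 0) -> w = 0.
Proof.
move=> w0; apply: eq_row3; rewrite mxE.
- by have := w0 (row3 1 0 0); rewrite /dot !row3E => <-; ring.
- by have := w0 (row3 0 1 0); rewrite /dot !row3E => <-; ring.
- by have := w0 (row3 0 0 1); rewrite /dot !row3E => <-; ring.
Qed.

Lemma exists_dot_neq0 w : w != 0 -> exists v, dot w v != 0.
Proof.
move=> /neq0_row3/or3P[] h.
- by exists (row3 1 0 0); move: h; congr (_ != 0); rewrite /dot !row3E; ring.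
- by exists (row3 0 1 0); move: h; congr (_ != 0); rewrite /dot !row3E; ring.
- by exists (row3 0 0 1); move: h; congr (_ != 0); rewrite /dot !row3E; ring.
Qed.

Lemma cross_eq0 u v : u != 0 -> cross u v = 0 -> exists c, v = c *: u.
Proof.
move=> u0 /rowP c0.
have [] : [/\ cross u v 0 0 = 0, cross u v 0 1 = 0 & cross u v 0 2 = 0].
  by split; rewrite c0 mxE.
rewrite /cross !row3E => /subr0_eq e0 /subr0_eq e1 /subr0_eq e2.
case/neq0_row3/or3P: u0 => h.
- exists (v 0 0 / u 0 0); apply: eq_row3; rewrite mxE; apply: (mulfI h).
  + by field.
  + by rewrite e2; field.
  + by rewrite -e1; field.
- exists (v 0 1 / u 0 1); apply: eq_row3; rewrite mxE; apply: (mulfI h).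
  + by rewrite -e2; field.
  + by field.
  + by rewrite e0; field.
- exists (v 0 2 / u 0 2); apply: eq_row3; rewrite mxE; apply: (mulfI h).
  + by rewrite e1; field.
  + by rewrite -e0; field.
  + by field.
Qed.

(** The vectors [u] and [v] form a basis of the plane orthogonal to [w]. Taking for [c] a nonzero
    coordinate of [w] keeps the witnesses free of divisions. *)
Lemma exists_cross w : w != 0 ->
  exists u v c, [/\ c != 0, cross u v = c *: w, dot w u = 0 & dot w v = 0].
Proof.
move=> /neq0_row3/or3P[] h.
- exists (row3 (w 0 1) (- w 0 0) 0), (row3 (w 0 2) 0 (- w 0 0)), (w 0 0).
  split=> //; first by [apply: eq_row3; rewrite /cross !(row3E, mxE) /=; ring].
  by rewrite /dot !row3E; ring.
  by rewrite /dot !row3E; ring.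
- exists (row3 (w 0 1) (- w 0 0) 0), (row3 0 (w 0 2) (- w 0 1)), (w 0 1).
  split=> //; first by [apply: eq_row3; rewrite /cross !(row3E, mxE) /=; ring].
  by rewrite /dot !row3E; ring.
  by rewrite /dot !row3E; ring.
- exists (row3 (w 0 2) 0 (- w 0 0)), (row3 0 (w 0 2) (- w 0 1)), (w 0 2).
  split=> //; first by [apply: eq_row3; rewrite /cross !(row3E, mxE) /=; ring].
  by rewrite /dot !row3E; ring.
  by rewrite /dot !row3E; ring.
Qed.

Lemma det3_span u v w : cross u v != 0 -> det3 u v w = 0 ->
  exists s t, w = s *: u + t *: v.
Proof.
move=> /exists_dot_neq0[x]; rewrite -/(det3 u v x) => D0 Dw.
have := cramer3 u v x w; rewrite Dw scale0r addr0 => e.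
exists ((det3 u v x)^-1 * det3 v x w), ((det3 u v x)^-1 * det3 x u w).
by rewrite -!scalerA -scalerDr -e scalerA mulVf ?scale1r.
Qed.

Lemma ev_comb3 a s t r u v w :
  ev a (s *: u + t *: v + r *: w) = s ^+ 2 * ev a u + t ^+ 2 * ev a v
    + r ^+ 2 * ev a w + s * t * polar a u v + s * r * polar a u w
    + t * r * polar a v w.
Proof. by rewrite /ev /polar !mxE; ring. Qed.

(** The unit vectors give the coefficients of the squares, and their pairwise sums then give the
    mixed ones. So over every field, even with two elements, identities between forms can be checked
    on values. *)
Lemma ev_inj a b : ev a =1 ev b -> a = b.
Proof.
move=> eab; have {eab} e v : ev (a - b) v = 0.
  by rewrite -scaleN1r evD evZ eab; ring.
apply: subr0_eq; move: (a - b) e => {a b} a e.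
have h (x y z : K) : a 0 0 * (x * x) + a 0 1 * (x * y) + a 0 2 * (x * z) +
  a 0 3 * (y * y) + a 0 4 * (y * z) + a 0 5 * (z * z) = 0.
  by have := e (row3 x y z); rewrite /ev !row3E.
have h0 : a 0 0 = 0 by rewrite -(h 1 0 0); ring.
have h3 : a 0 3 = 0 by rewrite -(h 0 1 0); ring.
have h5 : a 0 5 = 0 by rewrite -(h 0 0 1); ring.
have h1 : a 0 1 = 0 by rewrite -(h 1 1 0) h0 h3; ring.
have h2 : a 0 2 = 0 by rewrite -(h 1 0 1) h0 h5; ring.
have h4 : a 0 4 = 0 by rewrite -(h 0 1 1) h5 h3; ring.
apply/rowP => -[[|[|[|[|[|[|//]]]]]] i6]; rewrite mxE;
  [rewrite -h0 | rewrite -h1 | rewrite -h2 | rewrite -h3 | rewrite -h4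
  | rewrite -h5]; congr (a _ _); exact: val_inj.
Qed.

Lemma ev0 v : ev 0 v = 0.
Proof. by rewrite /ev !mxE; ring. Qed.

Lemma ev_scale_inj c a b : c != 0 -> (forall v, c * ev a v = ev b v) ->
  a = c^-1 *: b.
Proof.
by move=> c0 e; apply: ev_inj => v; rewrite evZ -e mulKf.
Qed.

Lemma evr0 a : ev a 0 = 0.
Proof. by rewrite /ev !mxE; ring. Qed.

(* Writing a vector in a basis (u, v, w) with [u, v] spanning the line, all
   terms of the form without the third coordinate vanish. *)
Lemma ev_line_factor a w : w != 0 ->
  (forall v, dot w v = 0 -> ev a v = 0) -> exists m, a = mul_lin w m.
Proof.
move=> w0 aw0; have [u [v [c [c0 cuv wu wv]]]] := exists_cross w0.
have [x x0] := exists_dot_neq0 w0.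
have D0 : det3 u v x != 0 by rewrite /det3 cuv dotC dotZ dotC mulf_neq0.
have [au av] := (aw0 _ wu, aw0 _ wv).
have puv : polar a u v = 0.
  have := ev_polar a 1 1 u v; rewrite !scale1r aw0 ?dotD ?wu ?wv ?addr0 //.
  by rewrite au av => ->; ring.
(* In the expansion by [cramer3] all remaining terms contain [det3 u v y], a multiple of [dot w y];
   [m] collects the cofactor. *)
pose m := polar a u x *: cross v x + polar a v x *: cross x u
          + ev a x *: cross u v.
exists (((det3 u v x) ^+ 2)^-1 * c *: m).
have -> : a = (det3 u v x ^+ 2)^-1 *: mul_lin (c *: w) m.
  apply: ev_scale_inj => [|y]; first by rewrite expf_neq0.
  rewrite -evZr cramer3 ev_comb3 au av puv ev_mul_lin -cuv.
  have -> : dot m y = polar a u x * det3 v x y + polar a v x * det3 x u y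
     + ev a x * det3 u v y.
     by rewrite /m /det3 !(dotC _ y) !dotD !dotZ.
  by rewrite -/(det3 u v y); ring.
by apply: ev_inj => y; rewrite evZ !ev_mul_lin !(dotC _ y) !dotZ; ring.
Qed.

(* The form only involves the two coordinates transverse to [u]. *)
Lemma ev_cone a u : u != 0 -> ev a u = 0 -> (forall v, polar a u v = 0) ->
  exists m1 m2 r s t,
    a = r *: mul_lin m1 m1 + s *: mul_lin m1 m2 + t *: mul_lin m2 m2.
Proof.
move=> u0 au pu.
have [w w0] : exists w, cross u w != 0.
  have [x x0] := exists_dot_neq0 u0.
  have [v [w [c [c0 cvw _ _]]]] := exists_cross u0.
  case: (eqVneq (cross u v) 0) => [|h]; last by exists v.
  case: (eqVneq (cross u w) 0) => [|h]; last by exists w.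
  move=> /(cross_eq0 u0)[d wE] /(cross_eq0 u0)[e vE].
  move: cvw; rewrite wE vE => /(congr1 (dot x)).
  rewrite dotZ => h; exfalso; move/eqP: h.
  have -> : dot x (cross (e *: u) (d *: u)) = 0.
    by rewrite /dot /cross !row3E !mxE; ring.
  by rewrite eq_sym mulf_eq0 (negPf c0) dotC (negPf x0).
have [x D0] := exists_dot_neq0 w0; rewrite -/(det3 u w x) in D0.
exists (cross x u), (cross u w), ((det3 u w x ^+ 2)^-1 * ev a w),
  ((det3 u w x ^+ 2)^-1 * polar a w x), ((det3 u w x ^+ 2)^-1 * ev a x).
rewrite -!scalerA -!scalerDr; apply: ev_scale_inj => [|y].
  by rewrite expf_neq0.
rewrite -evZr cramer3 ev_comb3 au !pu !evD !evZ !ev_mul_lin /det3; ring.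
Qed.

End Coordinates.

(** * Forms as polynomials *)

Section Polynomials.
Variable K : fieldType.
Local Open Scope ring_scope.
Implicit Types (w m : 'rV[K]_3) (a : 'rV[K]_6) (p : {mpoly K[3]}).

Definition linp w : {mpoly K[3]} :=
  w 0 0 *: 'X_0 + w 0 1 *: 'X_1 + w 0 2 *: 'X_2.

Definition quadp a : {mpoly K[3]} :=
  a 0 0 *: ('X_0 * 'X_0) + a 0 1 *: ('X_0 * 'X_1) + a 0 2 *: ('X_0 * 'X_2)
  + a 0 3 *: ('X_1 * 'X_1) + a 0 4 *: ('X_1 * 'X_2) + a 0 5 *: ('X_2 * 'X_2).

Lemma meval_linp w (v : 'rV[K]_3) : (linp w).@[v 0] = dot w v.
Proof. by rewrite /linp !mevalD !mevalZ !mevalXU. Qed.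

Lemma meval_quadp a (v : 'rV[K]_3) : (quadp a).@[v 0] = ev a v.
Proof. by rewrite /quadp !mevalD !mevalZ !mevalM !mevalXU. Qed.

Lemma linp_homog w : linp w \is 1.-homog.
Proof.
by rewrite /linp; do !apply: rpredD; apply: rpredZ; rewrite dhomogX /= mdeg1.
Qed.

Lemma quadp_homog a : quadp a \is 2.-homog.
Proof.
rewrite /quadp; do !apply: rpredD; apply: rpredZ;
  by apply: (@dhomogM _ _ _ 1 _ 1); rewrite dhomogX /= mdeg1.
Qed.

Lemma quadp_mul_lin w m : quadp (mul_lin w m) = linp w * linp m.
Proof.
rewrite /quadp /mul_lin; set s := (X in row6 X).
have [-> -> -> -> [-> ->]] := row6E s; rewrite /s /= /linp.
by rewrite -!mul_mpolyC !mpolyCD !mpolyCM; ring.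
Qed.

Lemma coef_linp w i : (linp w)@_U_(i) = w 0 i.
Proof.
rewrite /linp !mcoeffD !mcoeffZ !mcoeffXU; move: i.
by apply: ord3_cases; rewrite /= ?mulr1 ?mulr0 ?addr0 ?add0r.
Qed.

Lemma mnm_addU_eq n (i j k l : 'I_n) :
  (U_(i) + U_(j) == U_(k) + U_(l))%MM
  = (i == k) && (j == l) || (i == l) && (j == k).
Proof.
apply/eqP/idP => [/mnmP e|]; last first.
  by case/orP=> /andP[/eqP-> /eqP->] //; rewrite addmC.
have ei := e i; have ej := e j; move: ei ej; rewrite !mnmDE !mnm1E !eqxx.
case: (eqVneq k i) => [->|nki]; rewrite ?eqxx /=.
  by move=> _ /addnI; rewrite (eq_sym j); case: (l == j).
case: (eqVneq l i) => [->|//]; rewrite ?eqxx /= => _.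
by rewrite addnC => /addIn; rewrite (eq_sym j); case: (k == j).
Qed.

Lemma mdeg2_addU n (k : 'X_{1..n}) :
  mdeg k = 2%N -> exists i j, k = (U_(i) + U_(j))%MM.
Proof.
move=> k2; have [i ki] : exists i, (0 < k i)%N.
  apply/existsP; move: k2; rewrite mdegE; apply: contra_eqT.
  rewrite negb_exists => /forallP k0; rewrite big1 // => i _.
  by have := k0 i; rewrite -eqn0Ngt => /eqP.
have le : (U_(i) <= k)%MM.
  by apply/mnm_lepP=> j; rewrite mnm1E; case: eqP => [<-|].
have kE := submK le; have : mdeg (k - U_(i))%MM == 1%N.
  by move: k2; rewrite -{1}kE mdegD mdeg1 addn1 => -[->].
by case/mdeg1P=> j /eqP e; exists j, i; rewrite -e kE.
Qed.

Lemma homog1_linp p : p \is 1.-homog -> exists w, p = linp w.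
Proof.
move=> p1; exists (\row_i p@_U_(i)); apply/mpolyP=> k.
case: (mdeg k =P 1%N) => [/eqP/mdeg1P[i /eqP->]|/eqP k1].
  by rewrite coef_linp mxE.
by rewrite (dhomog_nemf_coeff p1 k1) (dhomog_nemf_coeff (linp_homog _) k1).
Qed.

Lemma homog2_quadp p : p \is 2.-homog -> exists a, p = quadp a.
Proof.
move=> p2; pose c (i j : 'I_3) := p@_(U_(i) + U_(j)).
exists (row6 [:: c 0 0; c 0 1; c 0 2; c 1 1; c 1 2; c 2 2]).
set s := (X in row6 X); apply/mpolyP=> k.
case: (mdeg k =P 2%N) => [/mdeg2_addU[i [j ->]]|/eqP k2]; last first.
  by rewrite (dhomog_nemf_coeff p2 k2) (dhomog_nemf_coeff (quadp_homog _) k2).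
rewrite /quadp; have [-> -> -> -> [-> ->]] := row6E s; rewrite /s /=.
rewrite -!mpolyXD !mcoeffD !mcoeffZ !mcoeffX !mnm_addU_eq {s}.
move: i j; apply: ord3_cases; apply: ord3_cases; rewrite -/(c _ _);
  rewrite /= ?mulr1 ?mulr0 ?addr0 ?add0r // /c; congr (p@_ _); exact: addmC.
Qed.

Lemma coef0_linp w : (linp w)@_0 = 0.
Proof. by apply: (dhomog_nemf_coeff (linp_homog w)); rewrite /= mdeg0. Qed.

Lemma coef0_quadp a : (quadp a)@_0 = 0.
Proof. by apply: (dhomog_nemf_coeff (quadp_homog a)); rewrite /= mdeg0. Qed.

Lemma coef1_quadp a i : (quadp a)@_U_(i) = 0.
Proof. by apply: (dhomog_nemf_coeff (quadp_homog a)); rewrite /= mdeg1. Qed.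

Lemma linp_nonunit w : linp w \isn't a GRing.unit.
Proof.
apply/negP=> /andP[_]; by rewrite coef0_linp unitr0.
Qed.

Lemma quadp_nonunit a : quadp a \isn't a GRing.unit.
Proof.
apply/negP=> /andP[_]; by rewrite coef0_quadp unitr0.
Qed.

Lemma linp_eq0 w : (linp w == 0) = (w == 0).
Proof.
apply/eqP/eqP => [e|->]; first by apply/rowP=> i; rewrite -coef_linp e mcoeff0 mxE.
by rewrite /linp !mxE !scale0r !addr0.
Qed.

Lemma quadp0 : quadp 0 = 0.
Proof. by rewrite /quadp !mxE !scale0r !addr0. Qed.

Lemma quadp_eq0 a : (quadp a == 0) = (a == 0).
Proof.
apply/eqP/eqP => [e|->]; last exact: quadp0.
by apply: ev_inj => v; rewrite -meval_quadp e meval0 ev0.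
Qed.

(** [msize] is the degree plus one, so the bound says that the degree is at most 1. *)
Lemma msize2_affine p :
  (msize p <= 2)%N -> exists w, p = (p@_0)%:MP + linp w.
Proof.
move=> p2; exists (\row_i p@_U_(i)); apply/mpolyP=> k.
rewrite mcoeffD mcoeffC.
case: (mdeg k =P 0%N) => [/eqP|/eqP k0].
  rewrite mdeg_eq0 => /eqP ->; rewrite eqxx mulr1.
  by rewrite coef0_linp addr0.
rewrite -mdeg_eq0 (negPf k0) mulr0 add0r.
case: (mdeg k =P 1%N) => [/eqP/mdeg1P[i /eqP->]|/eqP k1].
  by rewrite coef_linp mxE.
rewrite (dhomog_nemf_coeff (linp_homog _) k1).
apply: memN_msupp_eq0; apply: msize_mdeg_ge; apply: leq_trans p2 _.
by case: (mdeg k) k0 k1 => [|[]].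
Qed.

Lemma msize1_unit p : p != 0 -> (msize p <= 1)%N -> p \is a GRing.unit.
Proof.
move=> p0 p1; have pE := msize1_polyC p1; apply/andP; split; first exact/eqP.
by rewrite unitfE; apply: contraNneq p0 => e; rewrite pE e mpolyC0.
Qed.

(* Comparing the terms of degree 0 and 1 of two affine factors of a form shows
   that both factors are homogeneous. *)
Lemma quadp_factor a (A B : {mpoly K[3]}) : a != 0 -> quadp a = A * B ->
  [\/ A \is a GRing.unit, B \is a GRing.unit | exists w m, a = mul_lin w m].
Proof.
move=> a0 e; have : A * B != 0 by rewrite -e quadp_eq0.
rewrite mulf_eq0 negb_or => /andP[A0 B0].
have [|A2] := leqP (msize A) 1; first by move/(msize1_unit A0); constructor 1.
have [|B2] := leqP (msize B) 1; first by move/(msize1_unit B0); constructor 2.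
have : (msize (A * B) <= 3)%N.
  rewrite -e msizeE; apply/bigmax_leqP_seq => k /(dhomog_mf (quadp_homog a)).
  by move=> /= ->.
rewrite msizeM // => s3; have [sA sB] : (msize A <= 2)%N /\ (msize B <= 2)%N.
  by move: A2 B2 s3; move: (msize A) (msize B) => x y; lia.
constructor 3; have [w Aw] := msize2_affine sA; have [m Bm] := msize2_affine sB.
set s := A@_0 in Aw; set t := B@_0 in Bm.
have e' : quadp a = (s * t)%:MP + (linp (s *: m + t *: w) + quadp (mul_lin w m)).
  rewrite e Aw Bm quadp_mul_lin mpolyCM /linp !mxE -!mul_mpolyC.
  by rewrite !mpolyCD !mpolyCM; ring.
have cE k : (quadp a)@_k = s * t * (k == 0%MM)%:R
    + ((linp (s *: m + t *: w))@_k + (quadp (mul_lin w m))@_k).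
  by rewrite e' mcoeffD [X in _ + X = _]mcoeffD mcoeffC.
have st : s * t = 0.
  have := cE 0%MM; rewrite eqxx mulr1.
  by rewrite coef0_linp !coef0_quadp !addr0.
have lin0 : s *: m + t *: w = 0.
  apply/rowP=> i; rewrite -coef_linp [RHS]mxE.
  by have := cE U_(i)%MM; rewrite mnm1_eq0 mulr0 !coef1_quadp add0r addr0.
have s0 : s = 0.
  apply/eqP; apply: contraNT B0 => s0; rewrite Bm.
  have t0 : t = 0 by move/eqP: st; rewrite mulf_eq0 (negPf s0) => /eqP.
  move: lin0; rewrite t0 scale0r addr0 => /eqP; rewrite scaler_eq0 (negPf s0).
  by move=> /eqP ->; rewrite mpolyC0 add0r linp_eq0.
have t0 : t = 0.
  apply/eqP; apply: contraNT A0 => t0; rewrite Aw s0 mpolyC0 add0r linp_eq0.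
  by move: lin0; rewrite s0 scale0r add0r => /eqP; rewrite scaler_eq0 (negPf t0).
exists w, m; move: e'; rewrite st lin0 mpolyC0 add0r.
have -> : linp 0 = 0 by apply/eqP; rewrite linp_eq0.
rewrite add0r => e'; apply: ev_inj => v; by rewrite -!meval_quadp e'.
Qed.

End Polynomials.

(** * Absolute irreducibility of quadratic forms *)

Section AbsIrreducible.
Variable F : fieldType.
Local Open Scope ring_scope.

Lemma map_quadp (K : fieldType) (f : {rmorphism F -> K}) (a : 'rV[F]_6) :
  map_mpoly f (quadp a) = quadp (map_mx f a).
Proof.
rewrite /quadp !rmorphD /= !map_mpolyZ !rmorphM /= !map_mpolyX !mxE.
by [].
Qed.

(** For reasons of degree a quadratic form can only factor properly into two linear forms, so
    irreducibility over an extension is the absence of such a splitting there. *)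
Lemma abs_irreducible_quadp (a : 'rV[F]_6) :
  abs_irreducible (quadp a) <->
  a != 0 /\ forall (K : fieldType) (f : {rmorphism F -> K}) w m,
      map_mx f a <> mul_lin w m.
Proof.
split=> [irr|[a0 nsplit] K f]; last first.
  rewrite map_quadp; split; rewrite ?quadp_eq0 ?map_mx_eq0 ?quadp_nonunit //.
  move=> A B /quadp_factor[|||[w [m]]]; rewrite ?map_mx_eq0; auto.
  by move/nsplit.
split=> [|K f w m e].
  by have [] := irr F idfun; rewrite map_quadp quadp_eq0 map_mx_eq0.
have [_ _] := irr K f; rewrite map_quadp e quadp_mul_lin => /(_ _ _ erefl).
by rewrite (negPf (linp_nonunit w)) (negPf (linp_nonunit m)) => -[].
Qed.

End AbsIrreducible.

(** * The projective plane in coordinates *)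

Section Geometry.
Variables (F : finFieldType) (P : finType).
Local Open Scope ring_scope.

(* [P] is the projective plane over [F], seen through homogeneous coordinates.
   The geometry is developed over an abstract [P] because computing with
   equality on the concrete type of points is expensive. *)
Record coordinates (rep : P -> 'rV[F]_3) : Prop := Coordinates {
  rep_neq0 : forall p, rep p != 0;
  rep_inj : forall p p' c, rep p' = c *: rep p -> p = p';
  rep_surj : forall v, v != 0 -> exists p c, c != 0 /\ rep p = c *: v
}.

Variable rep : P -> 'rV[F]_3.
Hypothesis hrep : coordinates rep.
Local Notation q := #|F|.
Implicit Types (p : P) (Z Y L : {set P}) (w m v : 'rV[F]_3)
  (a : 'rV[F]_6).

Lemma exists_point v : v != 0 -> exists p c, c != 0 /\ rep p = c *: v.
Proof. exact: rep_surj. Qed.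

Lemma cross_rep_neq0 p p' : (cross (rep p) (rep p') != 0) = (p != p').
Proof.
apply/idP/idP.
  apply: contraNneq => ->; apply/eqP; apply: eq_row3;
    by rewrite /cross ?row3E mxE; ring.
apply: contraNN => /eqP /(cross_eq0 (rep_neq0 hrep p))[c e].
exact/eqP/(rep_inj hrep e).
Qed.

Definition line w : {set P} := [set p | dot w (rep p) == 0].
Definition quadric a : {set P} := [set p | ev a (rep p) == 0].

Lemma in_line w p : (p \in line w) = (dot w (rep p) == 0).
Proof. by rewrite inE. Qed.

Lemma in_quadric a p : (p \in quadric a) = (ev a (rep p) == 0).
Proof. by rewrite inE. Qed.

Definition is_ln L := [exists w, (w != 0) && (L == line w)].

Lemma is_lnP L : reflect (exists2 w, w != 0 & L = line w) (is_ln L).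
Proof.
by apply: (iffP exists_inP) => -[w w0 /eqP]; exists w => //; apply/eqP.
Qed.

Lemma quadric_mul w m : quadric (mul_lin w m) = line w :|: line m.
Proof. by apply/setP=> p; rewrite !inE ev_mul_lin mulf_eq0. Qed.

(** For equal points the cross product is 0 and the [join] is the whole plane, so [join_l], [join_r]
    and [joinC] hold without assuming the points distinct. *)
Definition join p p' := line (cross (rep p) (rep p')).

Lemma in_join p p' x : (x \in join p p') = (det3 (rep p) (rep p') (rep x) == 0).
Proof. by rewrite inE. Qed.

Lemma join_l p p' : p \in join p p'.
Proof. by rewrite in_join det3uvu. Qed.

Lemma join_r p p' : p' \in join p p'.
Proof. by rewrite in_join det3uvv. Qed.

Lemma join_is_ln p p' : p != p' -> is_ln (join p p').
Proof.
by move=> h; apply/is_lnP; exists (cross (rep p) (rep p')); rewrite ?cross_rep_neq0.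
Qed.

Lemma lineZ c w : c != 0 -> line (c *: w) = line w.
Proof.
by move=> c0; apply/setP=> p; rewrite !inE !(dotC _ (rep p)) dotZ mulf_eq0 (negPf c0).
Qed.

Lemma line_join w p p' : w != 0 -> p != p' -> p \in line w -> p' \in line w ->
  line w = join p p'.
Proof.
rewrite !inE => w0 npp /eqP wp /eqP wp'.
have [c e] : exists c, cross (rep p) (rep p') = c *: w.
  apply: cross_eq0 w0 _; move: wp wp'; rewrite /dot => wp wp'.
  apply: eq_row3; rewrite /cross !row3E mxE.
  - transitivity (rep p 0 0 * 0 - rep p' 0 0 * 0 : F); last by ring.
    by rewrite -{1}wp' -wp; ring.
  - transitivity (rep p 0 1 * 0 - rep p' 0 1 * 0 : F); last by ring.
    by rewrite -{1}wp' -wp; ring.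
  - transitivity (rep p 0 2 * 0 - rep p' 0 2 * 0 : F); last by ring.
    by rewrite -{1}wp' -wp; ring.
rewrite /join e lineZ //; move: npp; rewrite -cross_rep_neq0 e.
by apply: contraNneq => ->; rewrite scale0r.
Qed.

Lemma is_ln_join L p p' : is_ln L -> p != p' -> p \in L -> p' \in L ->
  L = join p p'.
Proof. by move=> /is_lnP[w w0 ->]; apply: line_join. Qed.

Lemma eq_line L L' p p' : is_ln L -> is_ln L' -> p != p' ->
  p \in L -> p' \in L -> p \in L' -> p' \in L' -> L = L'.
Proof.
by move=> lL lL' npp pL pL' p'L p'L'; rewrite (is_ln_join lL npp) // (is_ln_join lL' npp).
Qed.

Lemma joinC p p' : join p p' = join p' p.
Proof. by apply/setP=> x; rewrite !in_join det3C12 oppr_eq0. Qed.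

Lemma in_join_rot p p' x : (x \in join p p') = (p \in join p' x).
Proof. by rewrite !in_join -det3_rot. Qed.

(** The cross product of the two coefficient vectors is a common zero. If it vanishes, the lines
    coincide and any point of one of them will do. *)
Lemma lines_meet L L' : is_ln L -> is_ln L' -> exists p, p \in L :&: L'.
Proof.
move=> /is_lnP[w w0 ->] /is_lnP[w' w0' ->].
have [/(cross_eq0 w0)[c w'E]|c0] := eqVneq (cross w w') 0; last first.
  have [p [c [_ pE]]] := exists_point c0; exists p; rewrite !inE pE !dotZ.
  by rewrite -!(dotC (cross _ _)) -!/(det3 _ _ _) det3uvu det3uvv mulr0 eqxx.
have [u [v [d [d0 e wu wv]]]] := exists_cross w0.
have u0 : u != 0.
  apply: contraTneq d0 => u0; rewrite negbK.
  have : d *: w = 0 by rewrite -e u0; apply: eq_row3; rewrite /cross ?row3E !mxE; ring.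
  by move/eqP; rewrite scaler_eq0 (negPf w0) orbF.
have [p [k [_ pE]]] := exists_point u0; exists p.
by rewrite !inE pE w'E !dotZ wu (dotC _ u) dotZ (dotC u) wu !mulr0 eqxx.
Qed.

Lemma exists_line_sep p p' : p != p' ->
  exists2 w, w != 0 & (p \in line w) && (p' \notin line w).
Proof.
rewrite -cross_rep_neq0 => /exists_dot_neq0[x]; rewrite -/(det3 _ _ x) => D0.
exists (cross (rep p) x).
  apply: contraNneq D0 => e; rewrite det3C23 /det3 e.
  by rewrite dotC dot0 oppr0.
by rewrite !inE -!/(det3 _ _ _) det3uvu eqxx det3C23 oppr_eq0.
Qed.

Lemma exists_line_avoid p : exists2 w, w != 0 & p \notin line w.
Proof.
have [w w0] := exists_dot_neq0 (rep_neq0 hrep p); exists w; last by rewrite inE dotC.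
by apply: contraNneq w0 => ->; rewrite dot0.
Qed.

(** On the line the form is binary in the coordinates with respect to [p1] and [p2]. These two zeros
    remove the square terms; at [p3] both coordinates are nonzero, so the mixed term vanishes
    too. *)
Lemma line_sub_quadric L a p1 p2 p3 : is_ln L -> uniq [:: p1; p2; p3] ->
  all (mem L) [:: p1; p2; p3] -> all (mem (quadric a)) [:: p1; p2; p3] ->
  L \subset quadric a.
Proof.
move=> lL; rewrite /= !inE !andbT negb_or -!cross_rep_neq0.
move=> /andP[/andP[n12 n13] n23] /and3P[L1 L2 L3] /and3P[/eqP a1 /eqP a2 /eqP a3].
have LE : L = join p1 p2 by apply: is_ln_join => //; rewrite -cross_rep_neq0.
have [|s [t e3]] := det3_span (w := rep p3) n12.
  by apply/eqP; rewrite -in_join -LE.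
have s0 : s != 0.
  apply: contraNneq n23 => s0; rewrite e3 s0 scale0r add0r crossZ.
  by apply/eqP/eq_row3; rewrite /cross !(row3E, mxE); ring.
have t0 : t != 0.
  apply: contraNneq n13 => t0; rewrite e3 t0 scale0r addr0 crossZ.
  by apply/eqP/eq_row3; rewrite /cross !(row3E, mxE); ring.
have p12 : polar a (rep p1) (rep p2) = 0.
  move: a3; rewrite e3 ev_polar a1 a2 !mulr0 add0r addr0 => /eqP.
  by rewrite !mulf_eq0 (negPf s0) (negPf t0) => /eqP.
apply/subsetP=> x; rewrite LE in_join => /eqP /(det3_span n12)[s' [t' e]].
by rewrite inE e ev_polar a1 a2 p12 !mulr0 !addr0.
Qed.

(** Each point carries q - 1 nonzero vectors, the multiples of its representative. The points of the
    plane, of lines and of conics are all counted through their vectors. *)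
Lemma card_homogeneous (S : pred 'rV[F]_3) :
  (forall c v, c != 0 -> S (c *: v) = S v) ->
  #|[set v | (v != 0) && S v]| = (q.-1 * #|[set p | S (rep p)]|)%N.
Proof.
move=> hS; rewrite -(cardsC1 (0 : F)) -cardsX.
rewrite -(card_in_imset (f := fun cp : F * P => cp.1 *: rep cp.2)).
  apply: eq_card => v; rewrite inE; apply/andP/imsetP => [[v0 Sv]|].
    have [p [c [c0 e]]] := exists_point v0; exists (c^-1, p) => /=.
      by rewrite !inE /= invr_eq0 c0 e hS.
    by rewrite e scalerA mulVf ?scale1r.
  case=> -[c p]; rewrite !inE /= => /andP[c0 Sp] ->.
  by rewrite hS // scaler_eq0 negb_or c0 (rep_neq0 hrep).
move=> [c p] [c' p']; rewrite !inE /= => /andP[c0 _] /andP[c0' _] e.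
have pp : p = p'.
  apply: (rep_inj hrep (c := c'^-1 * c)).
  by rewrite -scalerA e scalerA mulVf ?scale1r.
move: e; rewrite pp => /eqP; rewrite -subr_eq0 -scalerBl scaler_eq0.
by rewrite (negPf (rep_neq0 hrep _)) orbF subr_eq0 => /eqP ->.
Qed.

Lemma q_gt1 : (1 < q)%N. Proof. exact: card_finNzRing_gt1. Qed.

Lemma card_point : #|P| = (q ^ 2 + q + 1)%N.
Proof.
have := @card_homogeneous xpredT (fun _ _ _ => erefl).
have -> : #|[set v : 'rV[F]_3 | (v != 0) && true]| = (q ^ 3 - 1)%N.
  rewrite -[3%N]mul1n -card_mx subn1 -(cardsC1 (0 : 'rV[F]_3)).
  by apply: eq_card => v; rewrite !inE andbT.
have -> : #|[set p : P | xpredT (rep p)]| = #|P|.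
  by rewrite -cardsT; apply: eq_card => p; rewrite !inE.
have := q_gt1; move: (#|F|) (#|P|) => k N; nia.
Qed.

Lemma card_line L : is_ln L -> #|L| = q.+1.
Proof.
move=> /is_lnP[w w0 ->].
have := @card_homogeneous (fun v => dot w v == 0).
have [u [v [c [c0 e wu wv]]]] := exists_cross w0.
have u0 : cross u v != 0 by rewrite e scaler_eq0 negb_or c0.
have [x x0] := exists_dot_neq0 u0; rewrite -/(det3 u v x) in x0.
have : #|[set y | dot w y == 0]| = (q ^ 2)%N.
  rewrite expnS expn1 -card_prod -cardsT.
  rewrite -(card_imset (f := fun st : F * F => st.1 *: u + st.2 *: v)).
    apply: eq_card => y; rewrite inE; apply/eqP/imsetP => [wy|[st _ ->]].
      have [|s [t ->]] := det3_span (w := y) u0; last by exists (s, t).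
      by rewrite /det3 e dotC dotZ dotC wy mulr0.
    by rewrite dotD !dotZ wu wv !mulr0 addr0.
  move=> [s t] [s' t'] /= h.
  have hs y z : det3 v x (y *: u + z *: v) = y * det3 u v x.
    by rewrite /det3 /dot /cross !row3E !mxE; ring.
  have ht y z : det3 x u (y *: u + z *: v) = z * det3 u v x.
    by rewrite /det3 /dot /cross !row3E !mxE; ring.
  congr pair; apply: (mulIf x0).
    by rewrite -(hs s t) h hs.
  by rewrite -(ht s t) h ht.
have -> : #|[set y | dot w y == 0]| = (#|[set y | (y != 0) && (dot w y == 0)]|).+1.
  rewrite [LHS](cardsD1 (0 : 'rV[F]_3)) inE dot0 eqxx add1n; congr _.+1.
  by apply: eq_card => y; rewrite !inE.
move=> + h; rewrite {}h => [|d y d0]; last by rewrite dotZ mulf_eq0 (negPf d0).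
rewrite -/(line w); have := q_gt1; move: (#|F|) (#|line w|) => k N; nia.
Qed.

End Geometry.

(** * Flats and the dimension of the forms vanishing on them *)

Section Flats.
Variables (F : finFieldType) (P : finType).
Variable rep : P -> 'rV[F]_3.
Hypothesis hrep : coordinates rep.
Local Open Scope ring_scope.
Local Notation quadric := (quadric rep).
Local Notation join := (join rep).
Local Notation line := (line rep).
Local Notation is_ln := (is_ln rep).
Implicit Types (p x : P) (Z Y L : {set P}) (w m v : 'rV[F]_3)
  (a b : 'rV[F]_6).

Definition vcol p : 'cV[F]_6 := \col_i (veronese (rep p))`_i.

Lemma ev_vcol a p : a *m vcol p = (ev a (rep p))%:M.
Proof.
apply/matrixP=> i j; rewrite !ord1 !mxE eqxx mulr1n.
rewrite !big_ord_recl big_ord0 !mxE /ev /veronese /= addr0 !addrA !expr2.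
by do !congr (_ + _); congr (a _ _ * _); exact: val_inj.
Qed.

Definition forms_on Z : 'M[F]_6 := (\bigcap_(p in Z) kermx (vcol p))%MS.

Definition hd Z := \rank (forms_on Z).

Lemma sub_kermx_vcol a p : (a <= kermx (vcol p))%MS = (p \in quadric a).
Proof.
rewrite in_quadric; apply/sub_kermxP/eqP => [|e]; rewrite ev_vcol.
  by move/matrixP/(_ 0 0); rewrite !mxE eqxx mulr1n.
by rewrite e raddf0.
Qed.

Lemma sub_forms_on a Z : (a <= forms_on Z)%MS = (Z \subset quadric a).
Proof.
apply/sub_bigcapmxP/subsetP => h p /h; first by rewrite sub_kermx_vcol.
by rewrite sub_kermx_vcol.
Qed.

Lemma eq_hd (m : nat) (A : 'M[F]_(m, 6)) Z :
  (forall a, (a <= A)%MS = (Z \subset quadric a)) -> \rank A = hd Z.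
Proof.
move=> e; apply/eqmx_rank/andP; split; apply/rV_subP=> a.
  by rewrite e sub_forms_on.
by rewrite e sub_forms_on.
Qed.

Lemma hd_closure Y Z :
  (forall a, (Y \subset quadric a) = (Z \subset quadric a)) -> hd Y = hd Z.
Proof. by move=> e; apply: eq_hd => a; rewrite sub_forms_on. Qed.

Lemma hd0 : hd set0 = 6%N.
Proof.
rewrite -(mxrank1 F 6); apply/esym/eq_hd => a.
by rewrite submx1 sub0set.
Qed.

Lemma hd_subset Y Z : Y \subset Z -> (hd Z <= hd Y)%N.
Proof.
move=> sYZ; apply/mxrankS/rV_subP => a; rewrite !sub_forms_on.
exact: subset_trans.
Qed.

(** Evaluation at [p] is a linear functional on the forms vanishing on [Z], nonzero because of [a];
    its kernel has codimension 1. *)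
Lemma hd_setU1 p Z a : Z \subset quadric a -> p \notin quadric a ->
  hd Z = (hd (p |: Z)).+1.
Proof.
move=> aZ ap; rewrite /hd -(mxrank_mul_ker (forms_on Z) (vcol p)) -[RHS]add1n.
congr (_ + _)%N.
  apply/eqP; rewrite eqn_leq rank_leq_col lt0n mxrank_eq0.
  apply: contra ap => /eqP e; rewrite -sub_kermx_vcol.
  by apply: submx_trans (_ : forms_on Z <= _)%MS; [rewrite sub_forms_on | apply/sub_kermxP].
apply: eq_hd => b; rewrite sub_capmx sub_forms_on sub_kermx_vcol.
by rewrite subUset sub1set andbC.
Qed.

Lemma hd_gt0 a Z : a != 0 -> Z \subset quadric a -> (0 < hd Z)%N.
Proof.
move=> a0; rewrite -sub_forms_on => /mxrankS; apply: leq_trans.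
by rewrite lt0n mxrank_eq0.
Qed.

Lemma hd_gt0P Z : (0 < hd Z)%N -> exists2 a, a != 0 & Z \subset quadric a.
Proof.
rewrite lt0n mxrank_eq0 => /rowV0Pn[a]; rewrite sub_forms_on.
by exists a.
Qed.

Definition flat Z :=
  forall p, p \notin Z -> exists2 a, Z \subset quadric a & p \notin quadric a.

Lemma flat_hdU1 p Z : flat Z -> p \notin Z -> hd Z = (hd (p |: Z)).+1.
Proof. by move=> fZ /fZ[a]; apply: hd_setU1. Qed.

(** A point outside a flat strictly lowers the dimension, so a flat is maximal among the sets of its
    dimension. On complements this becomes the minimality in the theorem. *)
Lemma flat_eq Y Z : flat Y -> Y \subset Z -> (hd Y <= hd Z)%N -> Z = Y.
Proof.
move=> fY sYZ hYZ; apply/eqP; rewrite eqEsubset sYZ andbT.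
apply/subsetP=> p pZ; apply: contraLR hYZ => /(flat_hdU1 fY) ->.
by rewrite -ltnNge ltnS; apply: hd_subset; rewrite subUset sub1set pZ.
Qed.

Lemma flat_closed p Z : flat Z ->
  (forall a, Z \subset quadric a -> p \in quadric a) -> p \in Z.
Proof. by move=> fZ h; apply: contraT => /fZ[a /h ->]. Qed.

(** Reducible quadrics suffice for the flatness of small arcs and of unions of lines and points: it
    is enough to cover [Z] by two lines that avoid [p]. *)
Lemma lines_separate L L' Z p : is_ln L -> is_ln L' ->
  Z \subset L :|: L' -> p \notin L -> p \notin L' ->
  exists2 a, Z \subset quadric a & p \notin quadric a.
Proof.
move=> /is_lnP[w _ ->] /is_lnP[m _ ->] sZ pw pm.
by exists (mul_lin w m); rewrite quadric_mul // in_setU negb_or pw.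
Qed.

Lemma exists_sep p p' : p != p' -> exists L, [/\ is_ln L, p \in L & p' \notin L].
Proof.
move=> /(exists_line_sep hrep)[w w0 /andP[wp wp']]; exists (line w); split=> //.
by apply/is_lnP; exists w.
Qed.

Lemma flat0 : flat set0.
Proof.
move=> p _; have [w w0 pw] := exists_line_avoid hrep p.
have lw : is_ln (line w) by apply/is_lnP; exists w.
exact: (lines_separate lw lw (sub0set _) pw pw).
Qed.

Lemma flat2 p1 p2 : flat [set p1; p2].
Proof.
move=> p; rewrite !inE negb_or ![p == _]eq_sym => /andP[n1 n2].
have [L [lL L1 Lp]] := exists_sep n1; have [L' [lL' L2' Lp']] := exists_sep n2.
by apply: lines_separate lL lL' _ Lp Lp'; rewrite setUSS ?sub1set.
Qed.

Lemma join_inter p x p1 p2 : x != p -> p1 != p -> p2 != p ->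
  x \in join p p1 -> x \in join p p2 -> p2 \in join p p1.
Proof.
rewrite ![_ == p]eq_sym => nx n1 n2 x1 x2.
rewrite (eq_line hrep (join_is_ln hrep n1) (join_is_ln hrep n2) nx
           (join_l _ _ _) x1 (join_l _ _ _) x2).
exact: join_r.
Qed.

Lemma sub2_join p1 p2 : [set p1; p2] \subset join p1 p2.
Proof.
by apply/subsetP=> x /set2P[] ->; [apply: join_l | apply: join_r].
Qed.

(** If [p] is off the line [p1] [p2], take this line and a line through [p3]. Otherwise [p] is not
    on the line [p2] [p3], which meets the former only in [p2]; take this second line and a line
    through [p1]. *)
Lemma flat3 p1 p2 p3 : p1 != p2 -> p1 != p3 -> p2 != p3 -> p3 \notin join p1 p2 ->
  flat [set p1; p2; p3].
Proof.
move=> n12 n13 n23 nc p.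
rewrite !inE !negb_or ![p == _]eq_sym => /andP[/andP[n1 n2] n3].
have [L [lL L1 Lp]] := exists_sep n1; have [L' [lL' L3 Lp']] := exists_sep n3.
have [p12|p12] := boolP (p \in join p1 p2); last first.
  apply: (lines_separate (join_is_ln hrep n12) lL' _ p12 Lp').
  by apply: setUSS; [apply: sub2_join | rewrite sub1set].
have p23 : p \notin join p2 p3.
  apply: contra nc => p23; rewrite joinC.
  by rewrite eq_sym in n2; rewrite eq_sym in n23;
    apply: (join_inter n2 n12 n23 _ p23); rewrite joinC.
apply: (lines_separate (join_is_ln hrep n23) lL _ p23 Lp).
by rewrite -setUA setUC; apply: setUSS; [apply: sub2_join | rewrite sub1set].
Qed.

(** Two of the three pairs of opposite sides suffice. A side of one pair meets a side of the other
    in a vertex, so a point that is not a vertex avoids both lines of at least one pair. *)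
Lemma flat4 p1 p2 p3 p4 : uniq [:: p1; p2; p3; p4] ->
  p3 \notin join p1 p2 -> p4 \notin join p1 p2 -> p4 \notin join p1 p3 ->
  p4 \notin join p2 p3 -> flat [set p1; p2; p3; p4].
Proof.
move=> u c123 c124 c134 c234; move: u; rewrite /= !inE !negb_or !andbT.
move=> /andP[/and3P[n12 n13 n14] /andP[/andP[n23 n24] n34]] p.
rewrite !inE !negb_or -!andbA => /and4P[n1 n2 n3 n4].
have [h|h] := boolP ((p \in join p1 p2) || (p \in join p3 p4)); last first.
  move: h; rewrite negb_or => /andP[h1 h2].
  apply: (lines_separate (join_is_ln hrep n12) (join_is_ln hrep n34) _ h1 h2).
  by rewrite -setUA setUSS ?sub2_join.
have n21 : p2 != p1 by rewrite eq_sym.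
have n31 : p3 != p1 by rewrite eq_sym.
have n42 : p4 != p2 by rewrite eq_sym.
have n43 : p4 != p3 by rewrite eq_sym.
apply: (lines_separate (join_is_ln hrep n13) (join_is_ln hrep n24) _ _ _).
- by rewrite (setUAC [set p1]) -setUA setUSS ?sub2_join.
- case/orP: h => h; apply/negP => h'.
    by move/negP: c123; apply; apply: (join_inter n1 n21 n31 h h').
  move/negP: c134; apply; rewrite joinC; rewrite joinC in h'.
  exact: (join_inter n3 n13 n43 h' h).
- case/orP: h => h; apply/negP => h'.
    move/negP: c124; apply; rewrite joinC; rewrite joinC in h.
    exact: (join_inter n2 n12 n42 h h').
  move/negP: c234; apply; rewrite 2!in_join_rot.
  rewrite joinC in h; rewrite joinC in h'.
  exact: (join_inter n4 n24 n34 h' h).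
Qed.

Lemma flat_line L : is_ln L -> flat L.
Proof.
by move=> lL p pL; apply: (lines_separate lL lL _ pL pL); rewrite setUid.
Qed.

Lemma flat_line_point L p : is_ln L -> flat (p |: L).
Proof.
move=> lL x; rewrite in_setU1 negb_or eq_sym => /andP[np xL].
have [L' [lL' pL' xL']] := exists_sep np.
by apply: lines_separate lL lL' _ xL xL'; rewrite setUC setUS // sub1set.
Qed.

Lemma flat_lines L L' : is_ln L -> is_ln L' -> flat (L :|: L').
Proof.
move=> lL lL' x; rewrite in_setU negb_or => /andP[xL xL'].
exact: (lines_separate lL lL' _ xL xL').
Qed.

Lemma hd2 p1 p2 : p1 != p2 -> hd [set p1; p2] = 4%N.
Proof.
move=> n; have := hd0; rewrite (flat_hdU1 flat0 (p := p1)) ?inE // setU0.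
have f1 : flat [set p1] by rewrite -[[set p1]]setUid; apply: flat2.
rewrite (flat_hdU1 f1 (p := p2)) ?inE 1?eq_sym // setUC.
by move=> -[].
Qed.

Lemma line_3points L : is_ln L -> exists p1 p2 p3,
  uniq [:: p1; p2; p3] /\ all (mem L) [:: p1; p2; p3].
Proof.
move=> lL; have : (2 < #|L|)%N by rewrite (card_line hrep lL) !ltnS q_gt1.
case/card_gt2P => p1 [p2 [p3 [[h1 h2 h3] [n12 n23 n31]]]]; exists p1, p2, p3.
by rewrite /= !inE h1 h2 h3 negb_or n12 n23 eq_sym n31.
Qed.

(** By [line_sub_quadric] three points of the line impose the same conditions as the whole line, and
    each of them lowers the dimension 6 by one. *)
Lemma hd_line L : is_ln L -> hd L = 3%N.
Proof.
move=> lL; have [p1 [p2 [p3 [u3 L3]]]] := line_3points lL.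
have : hd (p3 |: [set p1; p2]) = 3%N.
  move: u3; rewrite /= !inE !andbT negb_or => /andP[/andP[n12 n13] n23].
  have := hd2 n12; rewrite (flat_hdU1 (@flat2 p1 p2) (p := p3)); first by case.
  by rewrite !inE !(eq_sym p3) negb_or n13.
move=> <-; apply: hd_closure => a; apply/idP/idP.
  apply: subset_trans; rewrite !subUset !sub1set.
  by move: L3 => /= /and4P[-> -> ->].
rewrite !subUset !sub1set => /and3P[a3 a1 a2].
by apply: (line_sub_quadric hrep lL u3 L3); rewrite /= a1 a2 a3.
Qed.

Lemma hd_line_point L p : is_ln L -> p \notin L -> hd (p |: L) = 2%N.
Proof.
by move=> lL pL; have := flat_hdU1 (flat_line lL) pL; rewrite hd_line // => -[].
Qed.

(* A form vanishing on [L] and at two more points of [L'] vanishes at a third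
   point of [L'], where it meets [L], hence on [L']. *)
Lemma hd_lines_aux L L' p p' : is_ln L -> is_ln L' -> p != p' ->
  p \in L' -> p' \in L' -> p \notin L -> p' \notin L ->
  forall a, (p' |: (p |: L) \subset quadric a) = (L :|: L' \subset quadric a).
Proof.
move=> lL lL' n pL' p'L' pL p'L a; apply/idP/idP.
  rewrite !subUset !sub1set => /and3P[a' ap aL]; rewrite aL.
  have [x] := lines_meet hrep lL lL'; rewrite inE => /andP[xL xL'].
  apply: (line_sub_quadric hrep lL' (p1 := x) (p2 := p) (p3 := p')).
  - rewrite /= !inE !andbT negb_or n andbT; apply/andP.
    by split; [apply: contraNneq pL => <- | apply: contraNneq p'L => <-].
  - by rewrite /= xL' pL' p'L'.
  - by rewrite /= (subsetP aL) // ap a'.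
apply: subset_trans; rewrite setUA subUset subsetUl andbT subUset !sub1set.
by rewrite !inE pL' p'L' !orbT.
Qed.

Lemma line_2points_off L L' : is_ln L -> is_ln L' -> L != L' ->
  exists p p', [/\ p != p', p \in L', p' \in L', p \notin L & p' \notin L].
Proof.
move=> lL lL' nLL'; suff : (1 < #|L' :\: L|)%N.
  case/card_gt1P=> p [p' [+ + n]]; rewrite !inE => /andP[pL pL'] /andP[p'L p'L'].
  by exists p, p'.
have : (#|L' :&: L| <= 1)%N.
  rewrite leqNgt; apply: contra nLL' => /card_gt1P[p [p' [+ + n]]].
  rewrite !inE => /andP[pL' pL] /andP[p'L' p'L]; apply/eqP.
  exact: (eq_line hrep lL lL' n).
have := cardsID L L'; rewrite (card_line hrep lL'); have := q_gt1 F; lia.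
Qed.

Lemma hd_lines L L' : is_ln L -> is_ln L' -> L != L' -> hd (L :|: L') = 1%N.
Proof.
move=> lL lL' n; have [p [p' [npp pL' p'L' pL p'L]]] := line_2points_off lL lL' n.
rewrite -(hd_closure (hd_lines_aux lL lL' npp pL' p'L' pL p'L)).
have := hd_line_point lL pL; rewrite (flat_hdU1 (flat_line_point (p := p) lL) (p := p')).
  by case.
by rewrite in_setU1 negb_or p'L eq_sym npp.
Qed.

Lemma exists_off L : is_ln L -> exists p, p \notin L.
Proof.
move=> lL; apply/existsP; rewrite -negb_forall; apply/negP=> /forallP h.
have := card_point hrep; have := card_line hrep lL.
have -> : #|L| = #|P| by apply: eq_card => p; rewrite h.
by have := q_gt1 F; nia.
Qed.

(** Two lines leave one form up to scalars, and a point off both excludes it; there is one because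
    2q + 1 < q^2 + q + 1. In other words, the Veronese code has dimension 6. *)
Lemma hdT : hd setT = 0%N.
Proof.
have [p [p' n]] : exists p p' : P, p != p'.
  have : (1 < #|[set: P]|)%N by rewrite cardsT (card_point hrep); have := q_gt1 F; lia.
  by case/card_gt1P => p [p' [_ _ n]]; exists p, p'.
have l1 := join_is_ln hrep n; have [x xL] := exists_off l1.
have npx : p != x by apply: contraNneq xL => <-; apply: join_l.
have l2 := join_is_ln hrep npx.
have n12 : join p p' != join p x by apply: contraNneq xL => ->; apply: join_r.
have [y yL] : exists y, y \notin join p p' :|: join p x.
  apply/existsP; rewrite -negb_forall; apply/negP=> /forallP h.
  have := cardsUI (join p p') (join p x).
  have -> : #|join p p' :|: join p x| = #|P| by apply: eq_card => z; rewrite h.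
  rewrite (card_point hrep) (card_line hrep l1) (card_line hrep l2).
  have : (#|join p p' :&: join p x| > 0)%N.
    by apply/card_gt0P; exists p; rewrite inE !join_l.
  by have := q_gt1 F; nia.
have := hd_lines l1 l2 n12; rewrite (flat_hdU1 (flat_lines l1 l2) yL) => -[].
move=> e; apply/eqP; rewrite -leqn0 -e; apply: hd_subset; exact: subsetT.
Qed.

End Flats.

(** * Quadratic forms have rational zeros *)

Section PowerSums.
Variable F : finFieldType.
Local Open Scope ring_scope.
Local Notation q := #|F|.

Lemma card_natr_eq0 : q%:R = 0 :> F.
Proof.
have e := @cyclic.expg_cardG _ [set: F]%G (1%R : F) (in_setT _).
by rewrite -cardsT -FinRing.zmodXgE; exact: e.
Qed.

Lemma expf_card1 (x : F) : x != 0 -> x ^+ q.-1 = 1.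
Proof.
move=> x0; apply: (mulfI x0); rewrite -exprS prednK ?expf_card ?mulr1 //.
exact: (ltnW (q_gt1 F)).
Qed.

(** For k > 0 some [b] has [b ^+ k != 1], as the equation x^k = 1 has at most k < q - 1 roots, and
    replacing x by bx multiplies the sum by b^k. For k = 0 the sum is q = 0, with the convention
    that 0^0 = 1. *)
Lemma sum_expr k : (k < q.-1)%N -> \sum_(x : F) x ^+ k = 0.
Proof.
have [->|k0] := posnP k; move=> kq.
  under eq_bigr do rewrite expr0.
  by rewrite sumr_const card_natr_eq0.
have [b b0 bk] : exists2 b : F, b != 0 & b ^+ k != 1.
  apply/exists_inP; apply: contraLR kq; rewrite negb_exists_in -leqNgt => /forall_inP h.
  rewrite -(cardsC1 (0 : F)) cardE; apply: max_unity_roots => //; last exact: enum_uniq.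
  apply/allP=> x; rewrite mem_enum !inE unity_rootE => /h.
  by rewrite negbK.
have e : \sum_(x : F) x ^+ k = b ^+ k * \sum_(x : F) x ^+ k.
  rewrite {1}(reindex_inj (mulfI b0)) mulr_sumr.
  by apply: eq_bigr => x _; rewrite exprMn.
apply/eqP; move/eqP: e; rewrite -{1}[\sum_x _]mul1r -subr_eq0 -mulrBl mulf_eq0.
by rewrite subr_eq0 eq_sym (negPf bk).
Qed.

(** By the pigeonhole principle each monomial has an exponent below q - 1. Its sum over all vectors
    is a product of sums over the coordinates, one of which is 0 by [sum_expr]. *)
Lemma sum_meval n (P : {mpoly F[n]}) :
  {in msupp P, forall k, (mdeg k < n * q.-1)%N} ->
  \sum_(v : 'rV[F]_n) P.@[v 0] = 0.
Proof.
move=> hP; under eq_bigr do rewrite mevalE.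
rewrite exchange_big big1_seq //= => k /hP kq; rewrite -mulr_sumr.
have [i ki] : exists i, (k i < q.-1)%N.
  apply/existsP; apply: contraLR kq; rewrite negb_exists -leqNgt mdegE => /forallP h.
  rewrite -{1}[n]card_ord -sum_nat_const; apply: leq_sum => i _.
  by have := h i; rewrite -leqNgt.
rewrite (reindex (fun f : {ffun 'I_n -> F} => \row_i f i)) /=; last first.
  exists (fun v : 'rV_n => [ffun i => v 0 i]) => [f _|v _].
    by apply/ffunP=> j; rewrite ffunE mxE.
  by apply/rowP=> j; rewrite mxE ffunE.
under eq_bigr do under eq_bigr do rewrite mxE.
rewrite -(bigA_distr_bigA (fun i x => x ^+ k i)) (bigD1 i) //=.
by rewrite sum_expr // mul0r mulr0.
Qed.

(* The Chevalley-Warning argument: [1 - Q ^ (q - 1)] is the indicator of the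
   zeros of [Q], and its sum over all vectors is 0. *)
Lemma quadratic_form_isotropic (a : 'rV[F]_6) : exists2 v, v != 0 & ev a v = 0.
Proof.
case: (pickP [pred v : 'rV[F]_3 | (v != 0) && (ev a v == 0)]) => [v|h].
  by case/andP=> v0 /eqP av; exists v.
have q1 : (0 < q.-1)%N by have := q_gt1 F; case: (#|F|) => [|[]].
have s0 : \sum_(v : 'rV[F]_3) ev a v ^+ q.-1 = 0.
  transitivity (\sum_(v : 'rV[F]_3) (quadp a ^+ q.-1).@[v 0]).
    by apply: eq_bigr => v _; rewrite rmorphXn /= meval_quadp.
  apply: sum_meval => k /(dhomog_mf (dhomogMn _ (quadp_homog a))) /= ->.
  by rewrite ltn_mul2r q1.
have s1 : \sum_(v : 'rV[F]_3) (1 - ev a v ^+ q.-1) = 1.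
  rewrite (bigD1 (0 : 'rV[F]_3)) //= evr0 expr0n; have [e|_] := eqVneq q.-1 0%N.
    by rewrite e in q1.
  rewrite subr0 big1 ?addr0 // => v v0; have := h v; rewrite /= v0 /= => /negbT av.
  by rewrite expf_card1 ?subrr.
move: s1; rewrite sumrB s0 subr0 sumr_const card_mx mul1n natrX card_natr_eq0.
by rewrite expr0n => /esym/eqP; rewrite oner_eq0.
Qed.

End PowerSums.

(** * Arcs and irreducible conics *)

Section ConeSplits.
Variable F : finFieldType.
Local Open Scope ring_scope.

Lemma map_mul_lin (K : fieldType) (f : {rmorphism F -> K}) w m :
  map_mx f (mul_lin w m) = mul_lin (map_mx f w) (map_mx f m).
Proof.
apply/rowP=> i; rewrite /mul_lin !mxE.
by case: i => [[|[|[|[|[|[|//]]]]]]] /= _; rewrite ?rmorphD ?rmorphM.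
Qed.

(** The form r X^2 + s X Y + t Y^2 is (X - x Y)(r X + (s + r x) Y) for a root x of r x^2 + s x + t
    in an algebraic closure. If r = 0, the factor Y comes out. *)
Lemma binary_form_splits (r s t : F) :
  exists (K : fieldType) (f : {rmorphism F -> K}) (c1 d1 c2 d2 : K),
    [/\ f r = c1 * c2, f s = c1 * d2 + d1 * c2 & f t = d1 * d2].
Proof.
have [K [f _]] := countable_algebraic_closure F.
have [r0|r0] := eqVneq r 0.
  exists K, f, 0, 1, (f s), (f t); rewrite r0 rmorph0; split; ring.
have fr0 : f r != 0 by rewrite fmorph_eq0.
have [x] := @solve_monicpoly K 2 (fun i => [:: - f t / f r; - f s / f r]`_i) isT.
rewrite !big_ord_recl big_ord0 /= expr0 expr1 mulr1 addr0 => xE.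
exists K, f, 1, (- x), (f r), (f s + f r * x); split; first by ring.
  by ring.
have -> : - x * (f s + f r * x) = - (x * f s + f r * x ^+ 2) by ring.
by rewrite xE; field.
Qed.

(** A singular zero turns the form into a binary form in two linear forms. This may be irreducible
    over [F], but it splits over an extension. *)
Lemma abs_irreducible_not_cone (a : 'rV[F]_6) u : abs_irreducible (quadp a) ->
  u != 0 -> ev a u = 0 -> exists v, polar a u v != 0.
Proof.
move=> /abs_irreducible_quadp[a0 nsplit] u0 au.
case: (pickP [pred v : 'rV[F]_3 | polar a u v != 0]) => [v|h]; first by exists v.
have pu v : polar a u v = 0 by have := h v => /negbFE/eqP.
have [m1 [m2 [r [s [t aE]]]]] := ev_cone u0 au pu.
have [K [f [c1 [d1 [c2 [d2 [fr fs ft]]]]]]] := binary_form_splits r s t.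
case: (nsplit K f (c1 *: map_mx f m1 + d1 *: map_mx f m2)
                  (c2 *: map_mx f m1 + d2 *: map_mx f m2)).
apply: ev_inj => v; rewrite aE !map_mxD !map_mxZ !map_mul_lin fr fs ft.
rewrite !evD !evZ !ev_mul_lin !(dotC _ v) !dotD !dotZ; ring.
Qed.

Lemma abs_irreducible_no_line (a : 'rV[F]_6) w : abs_irreducible (quadp a) ->
  w != 0 -> exists2 v, dot w v = 0 & ev a v != 0.
Proof.
move=> /abs_irreducible_quadp[a0 nsplit] w0.
case: (pickP [pred v : 'rV[F]_3 | (dot w v == 0) && (ev a v != 0)]) => [v|h].
  by case/andP=> /eqP; exists v.
have [|m aE] := @ev_line_factor _ a w w0.
  by move=> v /eqP wv; have := h v; rewrite /= wv => /negbFE/eqP.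
case: (nsplit F idfun w m); rewrite aE map_mul_lin.
by rewrite !map_mx_id.
Qed.

(* The lines through a rational zero [u] other than the tangent each carry
   exactly one further zero. *)
Lemma card_zero_vectors (a : 'rV[F]_6) : abs_irreducible (quadp a) ->
  #|[set v | ev a v == 0]| = (#|F| ^ 2)%N.
Proof.
move=> irr; have [u u0 au] := quadratic_form_isotropic a.
have [w b0] := abs_irreducible_not_cone irr u0 au.
set b := polar a u w in b0.
have nuw : cross u w != 0.
  apply: contraNneq b0 => /(cross_eq0 u0)[c wE].
  by rewrite /b wE polarZ polarvv au mul0rn mulr0.
have [v3 D3] := exists_dot_neq0 nuw; rewrite -/(det3 u w v3) in D3.
(* Correcting [v3] along [w] moves it onto the tangent at [u]. The form is nonzero at [v2], since
   otherwise it would vanish on the whole tangent. *)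
pose v2 := v3 - (polar a u v3 / b) *: w.
have pv2 : polar a u v2 = 0.
  by rewrite /v2 -scaleNr polarD polarZ -/b; field.
have D : det3 u w v2 != 0.
  by rewrite /v2 -scaleNr det3D det3Z det3uvv mulr0 addr0.
have c0 : ev a v2 != 0.
  have n2 : cross u v2 != 0.
    apply: contraNneq D => e; rewrite det3C23 /det3 e.
    by rewrite dotC dot0 oppr0.
  have [v + av] := abs_irreducible_no_line irr n2.
  move=> /(det3_span n2)[s [t vE]]; apply: contraNneq av => c0.
  by rewrite vE ev_polar au c0 pv2 !mulr0 !addr0.
(* In the basis (u, w, v2) the form is linear in the coordinate along [u], with coefficient z b, so
   for z != 0 this is its only solution. For z = 0 the coordinate along [v2] must be 0 and that
   along [u] is free. *)
pose x (y z : F) :=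
  - (y ^+ 2 * ev a v2 + z ^+ 2 * ev a w + z * y * polar a w v2) / (z * b).
pose g (yz : F * F) : 'rV[F]_3 := let: (y, z) := yz in
  if z == 0 then y *: u else x y z *: u + z *: w + y *: v2.
have evE r z y : ev a (r *: u + z *: w + y *: v2)
    = y ^+ 2 * ev a v2 + z ^+ 2 * ev a w + z * y * polar a w v2 + r * (z * b).
  by rewrite ev_comb3 au pv2 -/b; ring.
have gE (y z : F) : exists r t, g (y, z) = r *: u + z *: w + t *: v2 /\
    (if z == 0 then r = y else t = y).
  rewrite /g; case: eqP => [->|_]; last by exists (x y z), y.
  by exists y, 0; rewrite !scale0r !addr0.
have coord r z t r' z' t' : r *: u + z *: w + t *: v2 = r' *: u + z' *: w + t' *: v2 ->
    [/\ r = r', z = z' & t = t'].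
  move=> e; split; apply: (mulIf D).
  - have h y1 y2 y3 : det3 w v2 (y1 *: u + y2 *: w + y3 *: v2) = y1 * det3 u w v2.
      by rewrite /det3 /dot /cross !row3E !mxE; ring.
    by rewrite -(h r z t) e h.
  - have h y1 y2 y3 : det3 v2 u (y1 *: u + y2 *: w + y3 *: v2) = y2 * det3 u w v2.
      by rewrite /det3 /dot /cross !row3E !mxE; ring.
    by rewrite -(h r z t) e h.
  - have h y1 y2 y3 : det3 u w (y1 *: u + y2 *: w + y3 *: v2) = y3 * det3 u w v2.
      by rewrite /det3 /dot /cross !row3E !mxE; ring.
    by rewrite -(h r z t) e h.
rewrite expnS expn1 -card_prod -cardsT -(card_imset (f := g)).
  apply: eq_card => v; rewrite inE; apply/eqP/imsetP => [av|[[y z] _ ->]].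
    have vE := cramer3 u w v2 v.
    have [r [z [y {}vE]]] : exists r z y, v = r *: u + z *: w + y *: v2.
      exists ((det3 u w v2)^-1 * det3 w v2 v), ((det3 u w v2)^-1 * det3 v2 u v),
        ((det3 u w v2)^-1 * det3 u w v).
      by rewrite -!scalerA -!scalerDr -vE scalerA mulVf ?scale1r.
    move: av; rewrite vE evE; have [->|z0] := eqVneq z 0.
      rewrite expr0n /= !mul0r mulr0 !addr0 => /eqP.
      rewrite mulf_eq0 (negPf c0) orbF expf_eq0 /= => /eqP ->.
      by exists (r, 0) => //; rewrite /g eqxx !scale0r !addr0.
    move=> av; exists (y, z) => //; rewrite /g (negPf z0); congr (_ *: _ + _ + _).
    apply: (mulIf (mulf_neq0 z0 b0)); rewrite /x divfK ?mulf_neq0 //.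
    by apply/eqP; rewrite -addr_eq0 addrC av.
  rewrite /g; have [_|z0] := eqVneq z 0; first by rewrite evZr au mulr0.
  by rewrite evE /x divfK ?mulf_neq0 // subrr.
move=> [y z] [y' z'] e.
have [r [t [gy hy]]] := gE y z; have [r' [t' [gy' hy']]] := gE y' z'.
rewrite gy gy' in e; have [er ez et] := coord _ _ _ _ _ _ e.
by move: hy hy'; rewrite -ez -er -et; case: eqP => _ -> ->.
Qed.

End ConeSplits.

Lemma uniq3P (T : eqType) (x y z : T) :
  reflect [/\ x != y, x != z & y != z] (uniq [:: x; y; z]).
Proof.
by rewrite /= !inE negb_or andbT -andbA; apply: (iffP and3P).
Qed.

Lemma card_set_seq (T : finType) (s : seq T) : uniq s -> #|[set x in s]| = size s.
Proof. by move=> u; rewrite cardsE; apply/card_uniqP. Qed.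

Lemma sub_set_seq (T : finType) (s : seq T) (Z : {set T}) :
  all (mem Z) s -> [set x in s] \subset Z.
Proof. by move=> /allP h; apply/subsetP=> x; rewrite inE; apply: h. Qed.

(** * Arcs, their dimension, and conics as arcs *)

Section Conics.
Variables (F : finFieldType) (P : finType).
Variable rep : P -> 'rV[F]_3.
Hypothesis hrep : coordinates rep.
Local Open Scope ring_scope.
Local Notation q := #|F|.
Local Notation quadric := (quadric rep).
Local Notation join := (join rep).
Local Notation is_ln := (is_ln rep).
Local Notation hd := (hd rep).
Local Notation flat := (flat rep).
Implicit Types (p x : P) (Z Y L : {set P}) (a : 'rV[F]_6).

Definition is_arc Z := [forall p1 in Z, forall p2 in Z, forall p3 in Z,
  uniq [:: p1; p2; p3] ==> (p3 \notin join p1 p2)].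

Lemma arcP Z : reflect
  (forall p1 p2 p3, p1 \in Z -> p2 \in Z -> p3 \in Z ->
     uniq [:: p1; p2; p3] -> p3 \notin join p1 p2) (is_arc Z).
Proof.
apply: (iffP forall_inP) => [h p1 p2 p3 z1 z2 z3 u|h p1 z1].
  exact: (implyP (forall_inP (forall_inP (h _ z1) _ z2) _ z3)).
by apply/forall_inP=> p2 z2; apply/forall_inP=> p3 z3; apply/implyP; apply: h.
Qed.

Lemma arcS Y Z : Y \subset Z -> is_arc Z -> is_arc Y.
Proof.
move=> /subsetP s /arcP h; apply/arcP=> p1 p2 p3 /s z1 /s z2 /s z3.
exact: h.
Qed.

Lemma arc_collinear Z : is_arc Z <->
  forall T : {set P}, T \subset Z -> #|T| = 3%N ->
    forall L, is_ln L -> ~~ (T \subset L).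
Proof.
split=> [/arcP h T sT T3 L lL|h].
  apply/negP=> sL; have : (2 < #|T|)%N by rewrite T3.
  case/card_gt2P=> p1 [p2 [p3 [[t1 t2 t3] [n12 n23 n31]]]].
  have u : uniq [:: p1; p2; p3] by apply/uniq3P; split; rewrite // eq_sym.
  have := h _ _ _ (subsetP sT _ t1) (subsetP sT _ t2) (subsetP sT _ t3) u.
  rewrite -(is_ln_join hrep lL n12 (subsetP sL _ t1) (subsetP sL _ t2)).
  by rewrite (subsetP sL _ t3).
apply/arcP=> p1 p2 p3 z1 z2 z3 u; apply/negP=> p3L.
have [n12 _ _] := elimT (uniq3P _ _ _) u.
have c3 : #|[set x in [:: p1; p2; p3]]| = 3%N by rewrite (card_set_seq u).
have sT : [set x in [:: p1; p2; p3]] \subset Z.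
  by apply: sub_set_seq; rewrite /= z1 z2 z3.
case/negP: (h _ sT c3 _ (join_is_ln hrep n12)).
by apply: sub_set_seq; rewrite /= join_l join_r p3L.
Qed.

Lemma not_arc_line Z : flat Z -> ~~ is_arc Z -> exists2 L, is_ln L & L \subset Z.
Proof.
move=> fZ /arcP nh.
have [p1 [p2 [p3 [z1 z2 z3 [u p3L]]]]] : exists p1 p2 p3,
    [/\ p1 \in Z, p2 \in Z, p3 \in Z & uniq [:: p1; p2; p3] /\ p3 \in join p1 p2].
  move: nh; rewrite -/(is_arc Z); case: (boolP (is_arc Z)) => [/arcP h /(_ h)//|+ _].
  rewrite negb_forall_in => /exists_inP[p1 z1].
  rewrite negb_forall_in => /exists_inP[p2 z2].
  rewrite negb_forall_in => /exists_inP[p3 z3].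
  by rewrite negb_imply negbK => /andP[u h]; exists p1, p2, p3.
have [n12 _ _] := elimT (uniq3P _ _ _) u.
exists (join p1 p2); first exact: (join_is_ln hrep n12).
apply/subsetP=> x xL; apply: (flat_closed fZ) => a /subsetP sa.
apply: (subsetP (line_sub_quadric hrep (join_is_ln hrep n12) u _ _)) xL.
  by rewrite /= join_l join_r p3L.
by rewrite /= !sa.
Qed.

Lemma flat_arc Z : is_arc Z -> (#|Z| <= 4)%N -> flat Z.
Proof.
move=> /arcP h Z4; have hE : Z = [set x in enum Z] by apply/setP=> x; rewrite inE mem_enum.
have uZ : uniq (enum Z) := enum_uniq _.
have {}h p1 p2 p3 : p1 \in enum Z -> p2 \in enum Z -> p3 \in enum Z ->
    uniq [:: p1; p2; p3] -> p3 \notin join p1 p2.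
  by rewrite !mem_enum; apply: h.
rewrite cardE in Z4; rewrite hE; move: (enum Z) uZ h Z4 {hE} => s.
case: s => [|p1 [|p2 [|p3 [|p4 [|? ?]]]]] u h // _.
- by rewrite set_nil; apply: flat0.
- have -> : [set x in [:: p1]] = [set p1; p1] by apply/setP=> x; rewrite !inE orbb.
  exact: flat2.
- have -> : [set x in [:: p1; p2]] = [set p1; p2] by apply/setP=> x; rewrite !inE.
  exact: flat2.
- have -> : [set x in [:: p1; p2; p3]] = [set p1; p2; p3].
    by apply/setP=> x; rewrite !inE orbA.
  have c := h p1 p2 p3; move: u; rewrite /= !inE !negb_or !andbT.
  move=> /andP[/andP[n12 n13] n23]; apply: flat3 => //.
  by apply: c; rewrite /= ?inE ?eqxx ?orbT ?negb_or ?n12 ?n13 ?n23.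
- have -> : [set x in [:: p1; p2; p3; p4]] = [set p1; p2; p3; p4].
    by apply/setP=> x; rewrite !inE !orbA.
  have u' : uniq [:: p1; p2; p3; p4] := u.
  move: u; rewrite /= !inE !negb_or !andbT.
  move=> /andP[/and3P[n12 n13 n14] /andP[/andP[n23 n24] n34]].
  by apply: flat4 => //; apply: h; rewrite /= ?inE ?eqxx ?orbT ?negb_or
    ?n12 ?n13 ?n14 ?n23 ?n24 ?n34.
Qed.

(** Without one of its points the arc has at most four points, hence is a flat, and the point lowers
    the dimension by one. This stops at five points, as a 5-arc is in general not flat. *)
Lemma hd_arc Z : is_arc Z -> (#|Z| <= 5)%N -> hd Z = (6 - #|Z|)%N.
Proof.
elim: {Z}#|Z| {-2}Z (erefl #|Z|) => [|k IH] Z Zk aZ Z5.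
  by move/eqP: Zk; rewrite cards_eq0 => /eqP ->; rewrite hd0 ?cards0.
have [p pZ] : exists p, p \in Z by apply/card_gt0P; rewrite Zk.
have Zp : #|Z :\ p| = k by move: Zk; rewrite (cardsD1 p) pZ => -[].
have aZp : is_arc (Z :\ p) by apply: arcS aZ; apply: subD1set.
have Z4 : (#|Z :\ p| <= 4)%N by rewrite Zp; move: Z5; rewrite Zk.
have := IH _ Zp aZp (leqW Z4); rewrite (flat_hdU1 (flat_arc aZp Z4) (p := p)).
  by rewrite setD1K // Zk Zp; move: Z5; rewrite Zk; lia.
by rewrite !inE eqxx.
Qed.

(** A decidable form of irreducible conics, needed to count them: [abs_irreducible] quantifies over
    all extension fields. The bound on the cardinality excludes the single rational point of two
    conjugate lines. *)
Definition conic_set Z := [&& is_arc Z, (4 < #|Z|)%N & [exists a, Z == quadric a]].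

Lemma card_subset_exists Z k : (k <= #|Z|)%N ->
  exists2 Y : {set P}, Y \subset Z & #|Y| = k.
Proof.
move=> kZ; have : (0 < #|[set A : {set P} | A \subset Z & #|A| == k]|)%N.
  by rewrite cards_draws bin_gt0.
by case/card_gt0P => Y; rewrite inE => /andP[sY /eqP]; exists Y.
Qed.

Lemma conic_abs_irreducible a : is_arc (quadric a) -> (4 < #|quadric a|)%N ->
  abs_irreducible (quadp a).
Proof.
move=> /arcP ha c5; apply/abs_irreducible_quadp.
(* A field embedding keeps the determinant of three points of the arc nonzero, so they stay
   independent over [K] and only the zero linear form vanishes at all of them. *)
have three_pts (K : fieldType) (f : {rmorphism F -> K}) (w : 'rV[K]_3) Y : Y \subset quadric a ->
    (2 < #|Y|)%N -> (forall p, p \in Y -> dot w (map_mx f (rep p)) = 0) -> w = 0.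
  move=> /subsetP sY /card_gt2P[p1 [p2 [p3 [[y1 y2 y3] [n12 n23 n31]]]]] h.
  have u : uniq [:: p1; p2; p3] by apply/uniq3P; split; rewrite // eq_sym.
  have := ha _ _ _ (sY _ y1) (sY _ y2) (sY _ y3) u; rewrite in_join => D0.
  apply: dot_eq0 => x; apply/eqP.
  have := cramer3 (map_mx f (rep p1)) (map_mx f (rep p2)) (map_mx f (rep p3)) x.
  move/(congr1 (dot w)); rewrite !dotD !dotZ !h // !mulr0 !addr0 => /eqP.
  rewrite mulf_eq0 => /orP[/eqP D|//]; case/negP: D0.
  rewrite -(fmorph_eq0 f); apply/eqP; rewrite -D.
  by rewrite /det3 /dot /cross !row3E !mxE !(rmorphD, rmorphN, rmorphM).
have a0 : a != 0.
  apply: contraTneq c5 => a0; rewrite -leqNgt leqNgt; apply/negP => c5.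
  have h p : p \in quadric a by rewrite in_quadric a0 ev0.
  have /card_gt1P[p1 [p2 [_ _ n12]]] : (1 < #|quadric a|)%N by apply: leq_trans c5.
  have lL := join_is_ln hrep n12.
  have [x1 [x2 [x3 [u /and4P[L1 L2 L3 _]]]]] := line_3points hrep lL.
  have [m12 _ _] := elimT (uniq3P _ _ _) u.
  have := ha _ _ _ (h x1) (h x2) (h x3) u.
  by rewrite -(is_ln_join hrep lL m12 L1 L2) => /negP[].
split=> // K f w m aE.
have wm0 : w = 0 \/ m = 0.
  pose A := quadric a :&: [set p | dot w (map_mx f (rep p)) == 0].
  (* Of at least five points, either three are zeros of [w] or three others are zeros of [m]. *)
  have [A3|A2] := ltnP 2 #|A|; [left | right].
    apply: (three_pts K f w A) => // [|p]; first exact: subsetIl.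
    by rewrite in_setI in_set => /andP[_ /eqP].
  apply: (three_pts K f m (quadric a :\: A)) => [||p]; first exact: subsetDl.
    have := cardsID A (quadric a).
    have := subset_leq_card (subsetIr (quadric a) A); lia.
  rewrite in_setD in_setI => /andP[+ pa]; rewrite pa /= in_set => /negPf wp.
  have : ev (mul_lin w m) (map_mx f (rep p)) = 0.
    move: pa; rewrite in_quadric -aE => /eqP e.
    by rewrite -(rmorph0 f) -e /ev !mxE !(rmorphD, rmorphM).
  by rewrite ev_mul_lin => /eqP; rewrite mulf_eq0 wp => /eqP.
case/eqP: a0; apply/eqP; rewrite -(map_mx_eq0 f) aE; apply/eqP/ev_inj => v.
rewrite ev_mul_lin ev0; case: wm0 => ->; rewrite [dot 0 v]dotC dot0.
  by rewrite mul0r.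
by rewrite mulr0.
Qed.

(** Three collinear zeros would put a whole line into the quadric and thus split the form. The q^2 -
    1 nonzero zeros, q - 1 to a point, give q + 1 points. *)
Lemma abs_irreducible_conic a : abs_irreducible (quadp a) ->
  is_arc (quadric a) /\ #|quadric a| = q.+1.
Proof.
move=> irr; split.
  apply/arcP=> p1 p2 p3 z1 z2 z3 u; apply/negP=> p3L.
  have [n12 _ _] := elimT (uniq3P _ _ _) u.
  have lL := join_is_ln hrep n12.
  have /subsetP sL : join p1 p2 \subset quadric a.
    apply: (line_sub_quadric hrep lL u); first by rewrite /= join_l join_r p3L.
    by rewrite /= z1 z2 z3.
  have /is_lnP[w w0 LE] := lL.
  have [v wv] := abs_irreducible_no_line irr w0; case/eqP.
  have [->|v0] := eqVneq v 0; first by rewrite evr0.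
  have [p [c [c0 e]]] := exists_point hrep v0.
  have /sL : p \in join p1 p2 by rewrite LE in_line e dotZ wv mulr0.
  rewrite in_quadric e evZr mulf_eq0 expf_eq0 (negPf c0) /=.
  by move/eqP.
have := card_homogeneous hrep (S := fun v => ev a v == 0).
have := card_zero_vectors irr.
rewrite (cardsD1 (0 : 'rV[F]_3)) in_set evr0 eqxx.
have -> : [set v | ev a v == 0] :\ 0 = [set v | (v != 0) && (ev a v == 0)].
  by apply/setP=> v; rewrite !inE.
move=> + h; rewrite {}h; last first.
  by move=> c v c0; rewrite evZr mulf_eq0 expf_eq0 (negPf c0).
rewrite -/(quadric a).
have := q_gt1 F; move: (#|F|) (#|quadric a|) => k N; nia.
Qed.

Lemma card_conic_set (Z : {set P}) : conic_set Z -> #|Z| = q.+1.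
Proof.
case/and3P=> aZ Z5 /existsP[a /eqP ZE]; rewrite ZE in aZ Z5 *.
by have [] := abs_irreducible_conic (conic_abs_irreducible aZ Z5).
Qed.

End Conics.

(** * Classification of the flats *)

Section Classification.
Variables (F : finFieldType) (P : finType).
Variable rep : P -> 'rV[F]_3.
Hypothesis hrep : coordinates rep.
Local Open Scope ring_scope.
Local Notation quadric := (quadric rep).
Local Notation join := (join rep).
Local Notation is_ln := (is_ln rep).
Local Notation hd := (hd rep).
Local Notation flat := (flat rep).
Local Notation is_arc := (is_arc rep).
Local Notation conic_set := (conic_set rep).
Implicit Types (p x : P) (Z Y L : {set P}) (a : 'rV[F]_6).

(** Two points of [Z] off [L] force the line joining them into [Z]. The two lines form a flat of
    dimension 1, so a larger set would have dimension 0. *)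
Lemma flat_line_cases Z L : flat Z -> (0 < hd Z)%N -> is_ln L -> L \subset Z ->
  [\/ Z = L, exists2 p, p \notin L & Z = p |: L
    | exists L', [/\ is_ln L', L != L' & Z = L :|: L']].
Proof.
move=> fZ hZ lL sLZ; have [->|nZL] := eqVneq Z L; first by constructor 1.
have [p pZ pL] : exists2 p, p \in Z & p \notin L.
  by apply/subsetPn; move: nZL; rewrite eqEsubset sLZ andbT.
have sZ : p |: L \subset Z by rewrite subUset sub1set pZ.
have [->|nZp] := eqVneq Z (p |: L); first by constructor 2; exists p.
have [p' p'Z] : exists2 p', p' \in Z & p' \notin p |: L.
  by apply/subsetPn; move: nZp; rewrite eqEsubset sZ andbT.
rewrite in_setU1 negb_or eq_sym => /andP[npp p'L].
have lL' := join_is_ln hrep npp.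
have nLL' : L != join p p' by apply: contraNneq pL => ->; apply: join_l.
constructor 3; exists (join p p'); split=> //.
apply: (flat_eq (flat_lines lL lL')); last by rewrite (hd_lines hrep).
apply/subsetP=> x xL; apply: (flat_closed fZ) => a sa; apply: (subsetP _ x xL).
rewrite -(hd_lines_aux hrep lL lL' npp (join_l _ _ _) (join_r _ _ _) pL p'L).
by apply: subset_trans sa; rewrite subUset sub1set p'Z.
Qed.

Lemma hd_arc_gt5 Z : is_arc Z -> (4 < #|Z|)%N -> (hd Z <= 1)%N.
Proof.
move=> aZ /card_subset_exists[Y sYZ Y5].
by apply: (leq_trans (hd_subset rep sYZ)); rewrite (hd_arc hrep (arcS sYZ aZ)) Y5.
Qed.

Lemma flat_cases Z : flat Z -> (0 < hd Z)%N ->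
  [\/ is_arc Z /\ (if (#|Z| <= 4)%N then hd Z = 6 - #|Z| else hd Z = 1)%N,
      is_ln Z /\ hd Z = 3%N,
      (exists L p, [/\ is_ln L, p \notin L & Z = p |: L]) /\ hd Z = 2%N
    | (exists L L', [/\ is_ln L, is_ln L', L != L' & Z = L :|: L']) /\ hd Z = 1%N].
Proof.
move=> fZ hZ; have [aZ|/(not_arc_line hrep fZ)[L lL sL]] := boolP (is_arc Z).
  constructor 1; split=> //; have [Z4|Z5] := leqP #|Z| 4.
    by rewrite (hd_arc hrep aZ) // leqW.
  by apply/eqP; rewrite eqn_leq hd_arc_gt5.
have [e|[p pL e]|[L' [lL' n e]]] := flat_line_cases fZ hZ lL sL.
- by constructor 2; rewrite e (hd_line hrep).
- by constructor 3; rewrite e (hd_line_point hrep) //; split=> //; exists L, p.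
- by constructor 4; rewrite e (hd_lines hrep) //; split=> //; exists L, L'.
Qed.

Lemma flat_quadric a : flat (quadric a).
Proof. by move=> p pa; exists a. Qed.

Lemma arc_meets_line Z L : is_arc Z -> is_ln L -> (#|Z :&: L| <= 2)%N.
Proof.
move=> /(arc_collinear hrep) h lL; rewrite leqNgt; apply/negP.
move=> /card_subset_exists[T sT T3]; move: sT; rewrite subsetI => /andP[sTZ sTL].
by have := h _ sTZ T3 _ lL; rewrite sTL.
Qed.

(** Dimension at most 1 excludes a line, with or without an extra point. Two lines are excluded
    because each contains at most two points of the arc. *)
Lemma arc5_conic Y a : is_arc Y -> #|Y| = 5%N -> a != 0 -> Y \subset quadric a ->
  conic_set (quadric a).
Proof.
move=> aY Y5 a0 sY; have hY : hd Y = 1%N by rewrite (hd_arc hrep aY) Y5.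
have hZ : (0 < hd (quadric a))%N by apply: hd_gt0 a0 _.
have hZ1 : (hd (quadric a) <= 1)%N by rewrite -hY; apply: hd_subset.
have [[aZ _]|[_ e]|[_ e]|[[L [L' [lL lL' _ e]]] _]] := flat_cases (@flat_quadric a) hZ.
- have Z5 := subset_leq_card sY; rewrite Y5 in Z5; rewrite /conic_set aZ Z5 /=.
  by apply/existsP; exists a.
- by rewrite e in hZ1.
- by rewrite e in hZ1.
have : (#|Y| <= #|Y :&: L| + #|Y :&: L'|)%N.
  rewrite -{1}(setIidPl sY) e setIUr cardsU; exact: leq_subr.
by rewrite Y5; have := arc_meets_line aY lL; have := arc_meets_line aY lL'; lia.
Qed.

Lemma conic_flat Z : conic_set Z -> flat Z /\ hd Z = 1%N.
Proof.
case/and3P=> aZ Z5 /existsP[a /eqP e].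
split; first by rewrite e; apply: flat_quadric.
apply/eqP; rewrite eqn_leq hd_arc_gt5 //=.
rewrite e in aZ Z5 *; apply: hd_gt0 (subxx _).
by have /abs_irreducible_quadp[] := conic_abs_irreducible hrep aZ Z5.
Qed.

(** A flat that contains [Y] and has the same dimension is the closure of [Y] under quadrics. *)
Lemma conic_unique Y Z Z' : flat Z -> flat Z' -> Y \subset Z -> Y \subset Z' ->
  hd Y = hd Z -> hd Y = hd Z' -> Z = Z'.
Proof.
have sub (X X' : {set P}) : flat X -> Y \subset X -> Y \subset X' -> hd Y = hd X' ->
    X' \subset X.
  move=> fX sX sX' hX'; apply/subsetP => p pX'; apply: contraT => /fX[a sa pa].
  have := hd_setU1 (subset_trans sX sa) pa; have : (hd X' <= hd (p |: Y))%N.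
    by apply: hd_subset; rewrite subUset sub1set pX'.
  by rewrite hX' => + e; rewrite {1}e ltnn.
move=> fZ fZ' sZ sZ' hZ hZ'; apply/eqP; rewrite eqEsubset.
by rewrite (sub _ _ fZ' sZ' sZ hZ) (sub _ _ fZ sZ sZ' hZ').
Qed.

Lemma small_arc Z : (#|Z| <= 2)%N -> is_arc Z.
Proof.
move=> Z2; apply/arcP=> p1 p2 p3 z1 z2 z3 u.
have : (3 <= #|Z|)%N.
  rewrite -[3%N]/(size [:: p1; p2; p3]) -(card_set_seq u).
  by apply/subset_leq_card/sub_set_seq; rewrite /= z1 z2 z3.
by move=> Z3; have := leq_trans Z3 Z2.
Qed.

(** In the arc case five points of [Z] already have dimension 1, so [Z] and the conic through them
    are both the closure of these points. *)
Lemma flat_hd1P Z : flat Z /\ hd Z = 1%N <->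
  (exists L L', [/\ is_ln L, is_ln L', L != L' & Z = L :|: L']) \/ conic_set Z.
Proof.
split=> [[fZ hZ]|[[L [L' [lL lL' n ->]]]|/conic_flat//]]; last first.
  by split; [apply: flat_lines | apply: hd_lines].
have [|[aZ]|[_]|[_]|[h _]] := flat_cases fZ; rewrite ?hZ //; last by left.
case: leqP => [|Z5 _]; first by case: (#|Z|) => [|[|[|[|[]]]]].
have [Y sYZ Y5] := card_subset_exists Z5.
have hY : hd Y = 1%N by rewrite (hd_arc hrep (arcS sYZ aZ)) Y5.
have [a a0 sa] : exists2 a, a != 0 & Z \subset quadric a by apply: hd_gt0P; rewrite hZ.
have cq := arc5_conic (arcS sYZ aZ) Y5 a0 (subset_trans sYZ sa).
right; rewrite (@conic_unique Y Z (quadric a)) ?hY ?hZ //.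
- by have [] := conic_flat cq.
- exact: subset_trans sa.
- by have [_ ->] := conic_flat cq.
Qed.

Lemma flat_hd2P Z : flat Z /\ hd Z = 2%N <->
  (exists L p, [/\ is_ln L, p \notin L & Z = p |: L]) \/ #|Z| = 4%N /\ is_arc Z.
Proof.
split=> [[fZ hZ]|[[L [p [lL pL ->]]]|[Z4 aZ]]]; last 2 first.
- by split; [apply: flat_line_point | apply: hd_line_point].
- by split; [apply: flat_arc; rewrite ?Z4 | rewrite (hd_arc hrep aZ) Z4].
have [|[aZ]|[_]|[h _]|[_]] := flat_cases fZ; rewrite ?hZ //; last by left.
by case: leqP => // _; right; split=> //; lia.
Qed.

Lemma flat_hd3P Z : flat Z /\ hd Z = 3%N <->
  is_ln Z \/ #|Z| = 3%N /\ is_arc Z.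
Proof.
split=> [[fZ hZ]|[lL|[Z4 aZ]]]; last 2 first.
- by split; [apply: flat_line | apply: hd_line].
- by split; [apply: flat_arc; rewrite ?Z4 | rewrite (hd_arc hrep aZ) Z4].
have [|[aZ]|[h _]|[_]|[_]] := flat_cases fZ; rewrite ?hZ //; last by left.
by case: leqP => // _; right; split=> //; lia.
Qed.

Lemma flat_hd_smallP Z k : (k <= 2)%N -> flat Z /\ hd Z = (6 - k)%N <-> #|Z| = k.
Proof.
move=> k2; split=> [[fZ hZ]|Zk]; last first.
  have aZ : is_arc Z by apply: small_arc; rewrite Zk.
  by split; [apply: (flat_arc hrep aZ) | rewrite (hd_arc hrep aZ)]; rewrite Zk; lia.
have [|[aZ]|[_]|[_]|[_]] := flat_cases fZ; rewrite ?hZ; try lia.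
by case: leqP; lia.
Qed.

Lemma hd_eq6 Z : hd Z = 6%N -> Z = set0.
Proof.
move=> hZ; apply/eqP; rewrite -subset0; apply/subsetP => p pZ.
have s : [set p] \subset Z by rewrite sub1set.
have := hd_subset rep s.
have {}aZ : is_arc [set p] by apply: small_arc; rewrite cards1.
by rewrite hZ (hd_arc hrep aZ) cards1.
Qed.

End Classification.

(** * Counting arcs and conics *)

(** Double counting of a set with a marked point: (Z, p) with p in Z corresponds to (Y, p) with p
    outside Y = Z minus p. *)
Lemma count_extensions (T : finType) (A B : {set {set T}}) k N :
  (forall Z, Z \in B -> #|Z| = k.+1) ->
  (forall Z p, Z \in B -> p \in Z -> Z :\ p \in A) ->
  (forall Y, Y \in A -> #|[set p | (p \notin Y) && (p |: Y \in B)]| = N) ->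
  k.+1 * #|B| = #|A| * N.
Proof.
move=> hB hBA hN.
pose S := [set Zp : {set T} * T | (Zp.1 \in B) && (Zp.2 \in Zp.1)].
pose S' := [set Yp : {set T} * T | [&& Yp.1 \in A, Yp.2 \notin Yp.1 & Yp.2 |: Yp.1 \in B]].
have cS : #|S| = k.+1 * #|B|.
  rewrite mulnC -sum_nat_const -sum1_card.
  rewrite (eq_bigl (fun Zp => (Zp.1 \in B) && (Zp.2 \in Zp.1))); last by move=> i; rewrite inE.
  rewrite -(pair_big_dep (mem B) (fun Z p => p \in Z) (fun _ _ => 1)) /=.
  by apply: eq_bigr => Z ZB; rewrite sum1_card hB.
have cS' : #|S'| = #|A| * N.
  rewrite -sum_nat_const -sum1_card.
  rewrite (eq_bigl (fun Yp => (Yp.1 \in A) && ((Yp.2 \notin Yp.1) && (Yp.2 |: Yp.1 \in B))));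
    last by move=> i; rewrite inE.
  rewrite -(pair_big_dep (mem A) (fun Y p => (p \notin Y) && (p |: Y \in B)) (fun _ _ => 1)) /=.
  by apply: eq_bigr => Y YA; rewrite -(hN _ YA) -sum1dep_card; apply: eq_bigl => p; rewrite ?inE.
rewrite -cS -cS' -(card_in_imset (f := fun Zp => (Zp.1 :\ Zp.2, Zp.2)) (D := mem S)).
  apply: eq_card => -[Y p]; rewrite inE /=; apply/imsetP/and3P.
    case=> -[Z x]; rewrite inE /= => /andP[ZB xZ] [-> ->].
    by rewrite hBA // !inE eqxx setD1K.
  case=> YA pY BY; exists (p |: Y, p); first by rewrite inE /= BY setU11.
  by rewrite /= setU1K.
move=> [Z x] [Z' x']; rewrite !inE /= => /andP[_ xZ] /andP[_ xZ'] [e ex].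
by rewrite -(setD1K xZ) e ex setD1K // -ex.
Qed.

(** Here k is q, [Ai] counts the i-arcs, [C] the conics, and [B] the 5-subsets of a conic. The
    common factor (k + 1) k (k - 1) (k - 2) (k - 3) is cancelled at the end; it is positive since k
    > 3. *)
Lemma conic_count_arith A1 A2 A3 A4 A5 C B k :
  A5 = C * B -> B * 120 = k.+1 * (k * (k.-1 * (k.-2 * k.-2.-1))) ->
  A1 = k ^ 2 + k + 1 -> 2 * A2 = A1 * (k ^ 2 + k) -> 3 * A3 = A2 * k ^ 2 ->
  4 * A4 = A3 * (k - 1) ^ 2 -> 5 * A5 = A4 * ((k - 2) * (k - 3)) -> 3 < k ->
  C = k ^ 5 - k ^ 2.
Proof.
case: k => [|[|[|[|j]]]] // c5 cb e1 e2 e3 e4 e5 _.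
rewrite !subSS !subn0 /= in cb e4 e5.
pose W := j.+2 * j.+1.
have f1 : C * (B * 120) = 120 * A5 by rewrite c5; lia.
have f2 : 120 * A5 = 24 * A4 * W by rewrite /W; lia.
have f3 : 24 * A4 = 6 * A3 * j.+3 ^ 2 by lia.
have f4 : 6 * A3 = 2 * A2 * j.+4 ^ 2 by lia.
have e : C * (j.+4.+1 * (j.+4 * (j.+3 * W)))
    = (A1 * (j.+4 ^ 2 + j.+4)) * j.+4 ^ 2 * j.+3 ^ 2 * W.
  by rewrite -e2 -f4 -f3 -f2 -f1 cb.
have e' : C * (j.+4.+1 * (j.+4 * (j.+3 * W)))
   = (j.+4 ^ 5 - j.+4 ^ 2) * (j.+4.+1 * (j.+4 * (j.+3 * W))).
  rewrite e e1 (_ : j.+4 ^ 5 - j.+4 ^ 2 = j.+4 ^ 2 * ((j.+4 ^ 2 + j.+4 + 1) * j.+3)).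
    by ring.
  by apply/eqP; rewrite -(eqn_add2r (j.+4 ^ 2)) subnK ?leq_exp2l //; apply/eqP; ring.
move/eqP: e'; rewrite eqn_pmul2r /W; last by lia.
by move/eqP.
Qed.

Section Counting.
Variables (F : finFieldType) (P : finType).
Variable rep : P -> 'rV[F]_3.
Hypothesis hrep : coordinates rep.
Local Open Scope ring_scope.
Local Notation q := #|F|.
Local Notation quadric := (quadric rep).
Local Notation join := (join rep).
Local Notation hd := (hd rep).
Local Notation is_arc := (is_arc rep).
Local Notation conic_set := (conic_set rep).
Implicit Types (p : P) (Z Y L : {set P}).

Definition arcs k : {set {set P}} := [set Z | is_arc Z & #|Z| == k].

Lemma arcsP k Z : reflect (is_arc Z /\ #|Z| = k) (Z \in arcs k).
Proof. by rewrite inE; apply: (iffP andP) => -[? /eqP]. Qed.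

Lemma arcU1 Y p : is_arc Y -> p \notin Y -> is_arc (p |: Y)
  = [forall p1 in Y, forall p2 in Y, (p1 != p2) ==> (p \notin join p1 p2)].
Proof.
move=> /arcP aY pY; apply/arcP/forall_inP => [h p1 y1|h p1 p2 p3].
  apply/forall_inP => p2 y2; apply/implyP => n12.
  apply: h; rewrite ?in_setU1 ?y1 ?y2 ?eqxx ?orbT //.
  by apply/uniq3P; split=> //; [apply: contraNneq pY => <- | apply: contraNneq pY => <-].
have {}h x1 x2 : x1 \in Y -> x2 \in Y -> x1 != x2 -> p \notin join x1 x2.
  by move=> y1 y2; apply/implyP/(forall_inP (h _ y1)).
move=> + + + /uniq3P[n12 n13 n23]; rewrite !in_setU1.
have [e1|n1] /= := eqVneq p1 p.
  rewrite -e1 ![_ == p1]eq_sym (negPf n12) (negPf n13) /= => _ y2 y3.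
  by rewrite in_join_rot e1; apply: h.
have [e2|n2] /= := eqVneq p2 p.
  rewrite -e2 ![_ == p2]eq_sym (negPf n23) /= => y1 _ y3.
  by rewrite 2!in_join_rot e2; apply: h; rewrite // eq_sym.
have [e3|n3] /= := eqVneq p3 p; first by move=> y1 y2 _; rewrite e3; apply: h.
move=> y1 y2 y3; apply: aY => //; exact/uniq3P.
Qed.

Lemma arcs_count k N :
  (forall Y, Y \in arcs k -> #|[set p | (p \notin Y) && is_arc (p |: Y)]| = N) ->
  (k.+1 * #|arcs k.+1| = #|arcs k| * N)%N.
Proof.
move=> hN; apply: count_extensions => [Z|Z p|Y Yk]; first by case/arcsP.
  move=> /arcsP[aZ Zk] pZ; apply/arcsP; split; first exact: arcS (subD1set _ _) aZ.
  by move: Zk; rewrite (cardsD1 p) pZ => -[].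
rewrite -(hN _ Yk); apply: eq_card => p; rewrite !in_set; have [//|pY] := boolP (p \in Y).
by rewrite cardsU1 pY; have /arcsP[_ ->] := Yk; rewrite eqxx andbT.
Qed.

Lemma card_arcs1 : #|arcs 1| = (q ^ 2 + q + 1)%N.
Proof.
rewrite -(card_point hrep) -[RHS]bin1 -card_draws; apply: eq_card => Z.
rewrite !inE; case: eqP => [Z1|]; rewrite ?andbF // andbT.
by apply: small_arc; rewrite Z1.
Qed.

Lemma card_arcs2 : (2 * #|arcs 2| = #|arcs 1| * (q ^ 2 + q))%N.
Proof.
apply: arcs_count => Y /arcsP[aY Y1].
have -> : [set p | (p \notin Y) && is_arc (p |: Y)] = ~: Y.
  apply/setP=> p; rewrite in_set in_setC; have [//|pY] := boolP (p \in Y).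
  by apply: small_arc; rewrite cardsU1 pY Y1.
by have := cardsC Y; rewrite Y1 (card_point hrep); lia.
Qed.

(* The condition [p \notin Y] becomes redundant: a point of [Y] is on the line
   that joins it to another point of [Y]. *)
Lemma arc_extensions Y : is_arc Y -> (1 < #|Y|)%N ->
  [set p | (p \notin Y) && is_arc (p |: Y)]
  = [set p | [forall p1 in Y, forall p2 in Y, (p1 != p2) ==> (p \notin join p1 p2)]].
Proof.
move=> aY Y1; apply/setP=> p; rewrite !in_set.
have [pY|pY] := boolP (p \in Y); last exact: arcU1.
apply/esym/negbTE/negP => /forall_inP h.
have [p1 [p2 [y1 y2 n12]]] := card_gt1P Y1.
have [x xY npx] : exists2 x, x \in Y & p != x.
  by have [e|] := eqVneq p p1; [exists p2; rewrite // e | exists p1].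
by have := implyP (forall_inP (h _ pY) _ xY) npx; rewrite join_l.
Qed.

Lemma card_arcs3 : (3 * #|arcs 3| = #|arcs 2| * q ^ 2)%N.
Proof.
apply: arcs_count => Y /arcsP[aY Y2]; rewrite arc_extensions ?Y2 //.
have /cards2P[p1 [p2 [n12 YE]]] : #|Y| == 2%N by rewrite Y2.
have -> : [set p | [forall x1 in Y, forall x2 in Y, (x1 != x2) ==> (p \notin join x1 x2)]]
    = ~: join p1 p2.
  apply/setP=> p; rewrite in_set in_setC YE; apply/forall_inP/idP => [h|pL x1 x1Y].
    by apply: (implyP (forall_inP (h _ (set21 _ _)) _ (set22 _ _)) n12).
  apply/forall_inP => x2 x2Y; apply/implyP.
  by case/set2P: x1Y => ->; case/set2P: x2Y => -> //; rewrite ?eqxx // joinC.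
have := cardsC (join p1 p2).
by rewrite (card_line hrep (join_is_ln hrep n12)) (card_point hrep); lia.
Qed.

(** * Coordinates relative to a triangle, for counting the extensions of arcs *)

Section Frame.
Variables (u v w : 'rV[F]_3).
Hypothesis D0 : det3 u v w != 0.

(** By [cramer3], the coordinates of [x] in the basis (u, v, w), all multiplied by the
    determinant. *)
Definition frame (x : 'rV[F]_3) : 'rV[F]_3 := row3 (det3 v w x) (det3 w u x) (det3 u v x).

Lemma frame_inj : injective frame.
Proof.
move=> x y e; suff /(scalerI D0) : det3 u v w *: x = det3 u v w *: y by [].
rewrite (cramer3 u v w x) (cramer3 u v w y).
have [] : [/\ frame x 0 0 = frame y 0 0, frame x 0 1 = frame y 0 1
    & frame x 0 2 = frame y 0 2] by rewrite e.
by rewrite !row3E => -> -> ->.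
Qed.

Lemma card_frame (S : pred 'rV[F]_3) : #|[set x | S (frame x)]| = #|[set y | S y]|.
Proof.
rewrite -(on_card_preimset (f := frame) (R := [set y | S y])).
  by apply: eq_card => x; rewrite !inE.
exact: (onW_bij _ (injF_bij frame_inj)).
Qed.

End Frame.

Lemma card_row3 (S : pred 'rV[F]_3) :
  #|[set y | S y]| = #|[set t : 3.-tuple F | S (row3 (tnth t 0) (tnth t 1) (tnth t 2))]|.
Proof.
have inj : injective (fun t : 3.-tuple F => row3 (tnth t 0) (tnth t 1) (tnth t 2)).
  move=> t t' e; apply/eq_from_tnth; apply: ord3_cases.
  - by move/rowP/(_ 0): e; rewrite !row3E0.
  - by move/rowP/(_ 1): e; rewrite !row3E1.
  - by move/rowP/(_ 2): e; rewrite !row3E2.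
rewrite -(card_imset _ inj); apply: eq_card => y; rewrite !inE.
apply/idP/imsetP => [Sy|[t]]; last by rewrite inE => St ->.
exists [tuple y 0 i | i < 3]; rewrite ?inE !tnth_mktuple.
  by rewrite (_ : row3 _ _ _ = y) //; apply: eq_row3; rewrite row3E.
by apply: eq_row3; rewrite row3E.
Qed.

Lemma all_tuple3 (t : 3.-tuple F) (a : pred F) :
  all a t = [&& a (tnth t 0), a (tnth t 1) & a (tnth t 2)].
Proof.
case: t => [[|x [|y [|z [|? ?]]]] //= st]; rewrite /= andbT.
by rewrite !(tnth_nth 0).
Qed.

Lemma uniq_tuple3 (t : 3.-tuple F) :
  uniq t = [&& tnth t 0 != tnth t 1, tnth t 0 != tnth t 2 & tnth t 1 != tnth t 2].
Proof.
case: t => [[|x [|y [|z [|? ?]]]] //= st].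
by rewrite /= !inE negb_or andbT -andbA !(tnth_nth 0).
Qed.

Lemma card_nonzero_row3 :
  #|[set y : 'rV[F]_3 | [&& y 0 0 != 0, y 0 1 != 0 & y 0 2 != 0]]| = (q.-1 ^ 3)%N.
Proof.
rewrite -(cardsC1 (0 : F)) expnSr expnSr expn1 -!cardsX.
pose g (t : F * F * F) := row3 t.1.1 t.1.2 t.2.
have inj : injective g.
  move=> [[x y] z] [[x' y'] z'] e; congr (_, _, _).
  - by move/rowP/(_ 0): e; rewrite !row3E0.
  - by move/rowP/(_ 1): e; rewrite !row3E1.
  - by move/rowP/(_ 2): e; rewrite !row3E2.
rewrite -[RHS](card_imset _ inj); apply: eq_card => y; rewrite inE.
apply/and3P/imsetP => [[y0 y1 y2]|[[[r s] t]]].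
  exists (y 0 0, y 0 1, y 0 2); first by rewrite !inE y0 y1 y2.
  by apply: eq_row3; rewrite row3E.
by rewrite !inE /= -andbA => /and3P[r0 s0 t0] ->; rewrite !row3E.
Qed.

Lemma card_off_triangle (u v w : 'rV[F]_3) : det3 u v w != 0 ->
  #|[set x | [&& det3 u v x != 0, det3 u w x != 0 & det3 v w x != 0]]| = (q.-1 ^ 3)%N.
Proof.
move=> D0; rewrite -card_nonzero_row3.
rewrite -(card_frame D0 (fun y => [&& y 0 0 != 0, y 0 1 != 0 & y 0 2 != 0])).
apply: eq_card => x; rewrite !inE !row3E (det3C12 w u) oppr_eq0.
by apply/and3P/and3P => -[-> -> ->].
Qed.

(* The basis is scaled so that the fourth vertex gets coordinates (1 : 1 : 1):
   the points on none of the six lines are those with nonzero, pairwise distinct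
   coordinates. *)
Lemma card_off_quadrangle (u v w t : 'rV[F]_3) : det3 u v w != 0 ->
  det3 u v t != 0 -> det3 u w t != 0 -> det3 v w t != 0 ->
  #|[set x | [&& det3 u v x != 0, det3 u w x != 0, det3 u t x != 0,
      det3 v w x != 0, det3 v t x != 0 & det3 w t x != 0]]| = (q.-1 ^_ 3)%N.
Proof.
move=> D0 Duv Duw Dvw; set c := det3 u v t in Duv.
pose b := det3 w u t; have b0 : b != 0 by rewrite /b det3C12 oppr_eq0.
set a := det3 v w t in Dvw.
have D1 : det3 (a *: u) (b *: v) (c *: w) != 0.
  have -> : det3 (a *: u) (b *: v) (c *: w) = a * b * c * det3 u v w.
    by rewrite /det3 /dot /cross !row3E !mxE; ring.
  by rewrite !mulf_neq0.
have e (x : 'rV[F]_3) : frame (a *: u) (b *: v) (c *: w) x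
    = row3 (b * c * det3 v w x) (c * a * det3 w u x) (a * b * det3 u v x).
  by apply: eq_row3; rewrite !row3E /det3 /dot /cross !row3E !mxE; ring.
have i1 (x : 'rV[F]_3) : c * a * det3 w u x - a * b * det3 u v x = - a * det3 u v w * det3 u t x.
  by rewrite /a /b /c /det3 /dot /cross !row3E; ring.
have i2 (x : 'rV[F]_3) : b * c * det3 v w x - a * b * det3 u v x = b * det3 u v w * det3 v t x.
  by rewrite /a /b /c /det3 /dot /cross !row3E; ring.
have i3 (x : 'rV[F]_3) : b * c * det3 v w x - c * a * det3 w u x = - c * det3 u v w * det3 w t x.
  by rewrite /a /b /c /det3 /dot /cross !row3E; ring.
have := card_uniq_tuples 3 (predC1 (0 : F)); rewrite cardC1 => <-.
pose S (y : 'rV[F]_3) := [&& y 0 0 != 0, y 0 1 != 0 & y 0 2 != 0]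
   && [&& y 0 0 != y 0 1, y 0 0 != y 0 2 & y 0 1 != y 0 2].
transitivity #|[set y | S y]|; last first.
  rewrite card_row3; apply: eq_card => s; rewrite !inE /S !row3E.
  by rewrite all_tuple3 uniq_tuple3.
rewrite -(card_frame D1); apply: eq_card => x; rewrite !inE /S e !row3E.
rewrite -(subr_eq0 (b * c * _) (c * a * _)) i3 -(subr_eq0 (b * c * _) (a * b * _)) i2
  -(subr_eq0 (c * a * _) (a * b * _)) i1.
rewrite (det3C12 u w) !mulf_eq0 !oppr_eq0 (negPf D0) (negPf Duv) (negPf b0) (negPf Dvw) /=.
by do 6!case: (det3 _ _ x == 0).
Qed.

Lemma card_set_exists (T : finType) (Y : {set T}) :
  exists s, [/\ uniq s, size s = #|Y| & Y = [set x in s]].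
Proof.
exists (enum Y); rewrite enum_uniq cardE; split=> //.
by apply/setP=> x; rewrite inE mem_enum.
Qed.

Lemma forall_pairs (T : finType) (R : rel T) (s : seq T) : ssrbool.symmetric R -> uniq s ->
  [forall x in [set x in s], forall y in [set x in s], (x != y) ==> R x y] = pairwise R s.
Proof.
move=> symR us.
transitivity (all2rel (fun x y => (x == y) || R x y) s).
  apply/forall_inP/allrelP => [h x y xs ys|h x].
    have := h x; rewrite inE => /(_ xs)/forall_inP/(_ y); rewrite inE => /(_ ys).
    by rewrite implyNb.
  rewrite inE => xs; apply/forall_inP=> y; rewrite inE => ys.
  by rewrite implyNb; apply: h.
rewrite -pairwise_all2rel; last 2 first.
- by move=> x; rewrite eqxx.
- by move=> x y; rewrite eq_sym symR.
elim: s us => //= x s IH /andP[xs us]; rewrite IH //; congr andb.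
apply: eq_in_all => y ys; case: eqVneq => // e; by rewrite e ys in xs.
Qed.

(** With two or more points in [s] there is a line to be avoided, which excludes the zero vector;
    the vectors counted are thus the multiples of the points that extend the arc. *)
Lemma card_off_lines (s : seq P) : uniq s -> is_arc [set x in s] -> (1 < size s)%N ->
  #|[set v | pairwise (fun p1 p2 => det3 (rep p1) (rep p2) v != 0) s]|
  = (q.-1 * #|[set p | (p \notin [set x in s]) && is_arc (p |: [set x in s])]|)%N.
Proof.
move=> us aY s1; rewrite arc_extensions // ?card_set_seq //.
pose S v := pairwise (fun p1 p2 => det3 (rep p1) (rep p2) v != 0) s.
have := card_homogeneous hrep (S := S).
have -> : [set v | (v != 0) && S v] = [set v | S v].
  apply/setP=> v; rewrite !inE; have [->|//] := eqVneq v 0.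
  by move: s1; rewrite /S; case: (s) => [|x [|y s']] //= _; rewrite /det3 dot0 eqxx.
move=> ->; last first.
  move=> c v c0; rewrite /S; apply: eq_pairwise => x y.
  by rewrite det3Z mulf_eq0 (negPf c0).
congr (_ * _)%N; apply: eq_card => p; rewrite !in_set forall_pairs //.
  by apply: eq_pairwise => x y; rewrite in_join.
by move=> x y; rewrite joinC.
Qed.

Lemma arc_det3 (s : seq P) p1 p2 p3 : is_arc [set x in s] -> subseq [:: p1; p2; p3] s ->
  uniq s -> det3 (rep p1) (rep p2) (rep p3) != 0.
Proof.
move=> /arcP h sub us; have := h p1 p2 p3; rewrite in_join; apply.
- by rewrite inE (mem_subseq sub) // !inE eqxx.
- by rewrite inE (mem_subseq sub) // !inE eqxx orbT.
- by rewrite inE (mem_subseq sub) // !inE eqxx !orbT.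
- exact: subseq_uniq sub us.
Qed.

Lemma card_arcs4 : (4 * #|arcs 4| = #|arcs 3| * (q - 1) ^ 2)%N.
Proof.
apply: arcs_count => Y /arcsP[aY Y3]; have [s [us ss YE]] := card_set_exists Y.
rewrite Y3 in ss; rewrite YE in aY *.
have := card_off_lines us aY; rewrite ss => /(_ isT).
case: s us ss aY {YE} => [|p1 [|p2 [|p3 []]]] // us _ aY.
have D : det3 (rep p1) (rep p2) (rep p3) != 0.
  by apply: (arc_det3 aY _ us); rewrite /= !eqxx.
rewrite (_ : [set v | _] = [set x | [&& det3 (rep p1) (rep p2) x != 0,
  det3 (rep p1) (rep p3) x != 0 & det3 (rep p2) (rep p3) x != 0]]); last first.
  by apply/setP=> v; rewrite !inE /= !andbT -!andbA.
rewrite (card_off_triangle D); have := q_gt1 F.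
by move: #|F| #|[set p | _]| => k N; nia.
Qed.

Lemma card_arcs5 : (5 * #|arcs 5| = #|arcs 4| * ((q - 2) * (q - 3)))%N.
Proof.
apply: arcs_count => Y /arcsP[aY Y3]; have [s [us ss YE]] := card_set_exists Y.
rewrite Y3 in ss; rewrite YE in aY *.
have := card_off_lines us aY; rewrite ss => /(_ isT).
case: s us ss aY {YE} => [|p1 [|p2 [|p3 [|p4 []]]]] // us _ aY.
have D1 : det3 (rep p1) (rep p2) (rep p3) != 0.
  by apply: (arc_det3 aY _ us); rewrite /= !eqxx.
have D2 : det3 (rep p1) (rep p2) (rep p4) != 0.
  apply: (arc_det3 aY _ us); exact: (mask_subseq [:: true; true; false; true] [:: p1; p2; p3; p4]).
have D3 : det3 (rep p1) (rep p3) (rep p4) != 0.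
  apply: (arc_det3 aY _ us); exact: (mask_subseq [:: true; false; true; true] [:: p1; p2; p3; p4]).
have D4 : det3 (rep p2) (rep p3) (rep p4) != 0.
  apply: (arc_det3 aY _ us); exact: (mask_subseq [:: false; true; true; true] [:: p1; p2; p3; p4]).
rewrite (_ : [set v | _] = [set x | [&& det3 (rep p1) (rep p2) x != 0,
  det3 (rep p1) (rep p3) x != 0, det3 (rep p1) (rep p4) x != 0,
  det3 (rep p2) (rep p3) x != 0, det3 (rep p2) (rep p4) x != 0
  & det3 (rep p3) (rep p4) x != 0]]); last first.
  by apply/setP=> v; rewrite !inE /= !andbT -!andbA.
rewrite (card_off_quadrangle D1 D2 D3 D4) ffactnS ffactnS ffactn1; have := q_gt1 F.
by move: #|F| #|[set p | _]| => k N; case: k => [|[|k]] //=; nia.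
Qed.

(* Double counting of 5-arcs in conics: a 5-arc lies on exactly one conic. *)
Lemma card_conics : (3 < q)%N -> #|[set Z | conic_set Z]| = (q ^ 5 - q ^ 2)%N.
Proof.
move=> q4.
have c5 : #|arcs 5| = (#|[set Z | conic_set Z]| * 'C(q.+1, 5))%N.
  rewrite -sum1_card -sum_nat_const.
  transitivity (\sum_(Z in [set Z | conic_set Z]) \sum_(Y in arcs 5 | Y \subset Z) 1)%N.
    rewrite (exchange_big_dep (mem (arcs 5))) /=; last by move=> ? ? _ /andP[].
    apply: eq_bigr => Y YA; have /arcsP[aY Y5] := YA.
    have hY : hd Y = 1%N by rewrite (hd_arc hrep aY) Y5.
    have [a a0 sa] : exists2 a, a != 0 & Y \subset quadric a by apply: hd_gt0P; rewrite hY.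
    have cq := arc5_conic hrep aY Y5 a0 sa; have [fq hq] := conic_flat hrep cq.
    rewrite (bigD1 (quadric a)) /=; last by rewrite YA sa in_set cq.
    rewrite big1 // => Z; rewrite YA in_set /= => /andP[/andP[cZ sZ] /eqP[]].
    have [fZ hZ] := conic_flat hrep cZ.
    by apply: (conic_unique fZ fq sZ sa); rewrite ?hZ ?hq.
  apply: eq_bigr => Z; rewrite inE => cZ; rewrite sum1dep_card.
  rewrite -(card_conic_set hrep cZ) -cards_draws; apply: eq_card => Y.
  rewrite !inE; have [sYZ|] := boolP (Y \subset Z); rewrite ?andbF //= andbT.
  by case/and3P: cZ => aZ _ _; rewrite (arcS sYZ aZ).
apply: (conic_count_arith c5 _ card_arcs1 card_arcs2 card_arcs3 card_arcs4 card_arcs5 q4).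
by rewrite -[120%N]/(5`!) bin_ffact !ffactnS ffactn0 muln1.
Qed.

End Counting.

(** * Counting lines *)

Section LineCounting.
Variables (F : finFieldType) (P : finType).
Variable rep : P -> 'rV[F]_3.
Hypothesis hrep : coordinates rep.
Local Open Scope ring_scope.
Local Notation q := #|F|.
Local Notation line := (line rep).
Local Notation is_ln := (is_ln rep).
Implicit Types (p : P) (Z Y L : {set P}).

(** Reading the coordinates of a point as those of a line is a duality. It is injective because the
    points of the line span the plane orthogonal to [rep p], which determines [rep p] up to a
    scalar. *)
Lemma line_rep_inj : injective (fun p => line (rep p)).
Proof.
move=> p p' /= e.
have [u [v [c [c0 cuv pu pv]]]] := exists_cross (rep_neq0 hrep p).
have perp x : x != 0 -> dot (rep p) x = 0 -> dot (rep p') x = 0.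
  move=> x0 px; have [y [d [d0 yE]]] := exists_point hrep x0.
  have : y \in line (rep p') by rewrite -e in_line yE dotZ px mulr0.
  by rewrite in_line yE dotZ mulf_eq0 (negPf d0) => /eqP.
have perp0 x : dot (rep p) x = 0 -> dot (rep p') x = 0.
  by have [->|] := eqVneq x 0; [rewrite !dot0 | apply: perp].
have : cross (rep p) (rep p') = 0.
  have -> : rep p = c^-1 *: cross u v by rewrite cuv scalerA mulVf ?scale1r.
  move: (perp0 _ pu) (perp0 _ pv); move: (rep p') => w wu wv.
  (* The expansion of the triple product (u x v) x w. *)
  transitivity (c^-1 *: (dot w u *: v - dot w v *: u)).
    by apply: eq_row3; rewrite /dot /cross !(mxE, row3E) /=; ring.
  by rewrite wu wv !scale0r subrr scaler0.
by move/(cross_eq0 (rep_neq0 hrep p)) => [d /(rep_inj hrep)].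
Qed.

Lemma card_lines : #|[set L | is_ln L]| = (q ^ 2 + q + 1)%N.
Proof.
rewrite -(card_point hrep) -cardsT -(card_imset _ line_rep_inj).
apply: eq_card => L; rewrite in_set; apply/is_lnP/imsetP => [[w w0 ->]|[p _ ->]].
  have [p [c [c0 e]]] := exists_point hrep w0.
  by exists p; rewrite // e lineZ.
by exists (rep p); rewrite ?rep_neq0.
Qed.

Lemma eq_line_cap L L' : is_ln L -> is_ln L' -> (1 < #|L :&: L'|)%N -> L = L'.
Proof.
move=> lL lL' /card_gt1P[p [p' [+ + n]]]; rewrite !in_setI.
by move=> /andP[pL pL'] /andP[p'L p'L']; apply: (eq_line hrep lL lL' n).
Qed.

(** At most one point of [L] is the extra point [p'], so at least q >= 2 points of [L] lie on
    [L']. *)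
Lemma line_point_inj : {in [set Lp : {set P} * P | is_ln Lp.1 && (Lp.2 \notin Lp.1)] &,
  injective (fun Lp => Lp.2 |: Lp.1)}.
Proof.
move=> [L p] [L' p']; rewrite !in_set /= => /andP[lL pL] /andP[lL' pL'] e.
have LL' : L = L'.
  apply: eq_line_cap => //; have : L \subset p' |: L' by rewrite -e subsetUr.
  move/setIidPl; rewrite setIUr => /(congr1 (fun A : {set P} => #|A|)).
  rewrite cardsU (card_line hrep lL).
  have := subset_leq_card (subsetIr L [set p']); rewrite cards1.
  by have := q_gt1 F; lia.
rewrite LL'; congr pair; rewrite -LL' in e.
have : p \in p' |: L by rewrite -e setU11.
by rewrite in_setU1 (negPf pL) orbF => /eqP.
Qed.

Lemma card_line_points :
  exists2 S : {set {set P}}, (forall Z, Z \in S <->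
     exists L p, [/\ is_ln L, p \notin L & Z = p |: L])
  & #|S| = (q ^ 2 * (q ^ 2 + q + 1))%N.
Proof.
exists [set Lp.2 |: Lp.1 | Lp in [set Lp : {set P} * P | is_ln Lp.1 && (Lp.2 \notin Lp.1)]].
  move=> Z; split=> [/imsetP[[L p]]|[L [p [lL pL ->]]]].
    by rewrite in_set /= => /andP[lL pL] ->; exists L, p.
  by apply/imsetP; exists (L, p); rewrite ?in_set //= lL.
rewrite (card_in_imset line_point_inj) -card_lines mulnC -sum_nat_const -sum1_card.
rewrite (eq_bigl (fun Lp : {set P} * P => is_ln Lp.1 && (Lp.2 \notin Lp.1)));
  last by move=> Lp; rewrite in_set.
rewrite -(pair_big_dep is_ln (fun L p => p \notin L) (fun _ _ => 1%N)) /=.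
rewrite [RHS](eq_bigl is_ln) => [|L]; last by rewrite in_set.
apply: eq_bigr => L lL; rewrite sum1_card.
transitivity #|~: L|; first by apply: eq_card => p; rewrite !inE.
have := cardsC L; rewrite (card_line hrep lL) (card_point hrep).
by move: #|F| #|~: L| => k N; lia.
Qed.

(** One of the two lines contains two of the at least three points of [K]. *)
Lemma line_sub_lines K L L' : is_ln K -> is_ln L -> is_ln L' -> K \subset L :|: L' ->
  K \in [set L; L'].
Proof.
move=> lK lL lL' sK; rewrite in_set2; apply/orP.
have [h|h] := ltnP 1 #|K :&: L|; first by left; apply/eqP/eq_line_cap.
have [h'|h'] := ltnP 1 #|K :&: L'|; first by right; apply/eqP/eq_line_cap.
move/setIidPl: sK; rewrite setIUr => /(congr1 (fun A : {set P} => #|A|)).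
by rewrite cardsU (card_line hrep lK); have := q_gt1 F; lia.
Qed.

(** Unordered pairs are 2-subsets of the set of lines, and [cover] sends a pair to its union. By
    [line_sub_lines] the union determines the pair. *)
Lemma card_line_pairs :
  exists2 S : {set {set P}}, (forall Z, Z \in S <->
     exists L L', [/\ is_ln L, is_ln L', L != L' & Z = L :|: L'])
  & #|S| = ((q * (q + 1) * (q ^ 2 + q + 1)) %/ 2)%N.
Proof.
pose lines := [set L | is_ln L].
pose D := [set A : {set {set P}} | A \subset lines & #|A| == 2].
have DP A : A \in D -> exists L L', [/\ is_ln L, is_ln L', L != L', A = [set L; L']
    & cover A = L :|: L'].
  rewrite in_set => /andP[/subsetP sA /cards2P[L [L' [n AE]]]]; exists L, L'.
  have := sA L; have := sA L'; rewrite AE !in_set2 !eqxx orbT /= !in_set => lL' lL.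
  split=> //; rewrite ?lL ?lL' //.
  by rewrite /cover bigcup_setU !big_set1.
exists [set cover A | A in D].
  move=> Z; split=> [/imsetP[A /DP[L [L' [lL lL' n _ e]]] ->]|[L [L' [lL lL' n ->]]]].
    by exists L, L'.
  apply/imsetP; exists [set L; L']; last by rewrite /cover bigcup_setU !big_set1.
  rewrite in_set cards2 n subUset !sub1set !in_set.
  by rewrite lL lL'.
rewrite card_in_imset => [|A B AD BD e].
  rewrite cards_draws card_lines bin2.
  rewrite (_ : (_ * _.-1)%N = (q * (q + 1) * (q ^ 2 + q + 1))%N) ?divn2 //.
  by rewrite addn1 /= addn1 -addn1; ring.
have [L [L' [lL lL' n AE cA]]] := DP _ AD; have [K [K' [lK lK' n' BE cB]]] := DP _ BD.
apply/esym/eqP; rewrite eqEcard AE BE !cards2 n n' andbT subUset !sub1set.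
by rewrite !line_sub_lines // -cA e cB ?subsetUl ?subsetUr.
Qed.

End LineCounting.

(** * The parity check matroid *)

Section LinearMatroidRank.
Variables (K : fieldType) (m : nat) (E : finType) (c : E -> 'cV[K]_m).
Local Open Scope ring_scope.
Implicit Types X Y : {set E}.

Definition rows_of X : 'M[K]_(#|X|, m) := \matrix_(i, j) c (enum_val i) j 0.

Lemma row_rows_of X i : row i (rows_of X) = (c (enum_val i))^T.
Proof. by apply/rowP=> j; rewrite !mxE. Qed.

Lemma rows_of_span X v : v \in <<[seq c x | x in X]>>%VS -> (v^T <= rows_of X)%MS.
Proof.
move=> /(@coord_span _ _ _ (image_tuple c X)) ->; rewrite linear_sum /=.
apply: summx_sub => i _; rewrite linearZ /=; apply: scalemx_sub.
have e : [seq c x | x in X]`_i = c (enum_val i).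
  rewrite (nth_map (enum_val i)) -?cardE //.
  by congr c; rewrite -enum_val_nth.
by rewrite e -row_rows_of row_sub.
Qed.

Lemma row_free_rows_of X : linear_indep c X -> row_free (rows_of X).
Proof.
move=> /(@freeP _ _ _ (image_tuple c X)) fX; apply: inj_row_free => u e.
apply/rowP=> i; rewrite mxE; apply: (fX (fun i => u 0 i)).
apply: trmx_inj; rewrite trmx0 -e mulmx_sum_row linear_sum /=.
apply: eq_bigr => j _; rewrite linearZ /= row_rows_of; congr (_ *: _^T).
rewrite (nth_map (enum_val j)) -?cardE //.
by congr c; rewrite -enum_val_nth.
Qed.

Lemma rows_ofS X Y : X \subset Y -> (rows_of X <= rows_of Y)%MS.
Proof.
move=> /subsetP sXY; apply/row_subP=> i; rewrite row_rows_of.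
have iY : enum_val i \in Y by apply/sXY/enum_valP.
by rewrite -(enum_rankK_in iY iY) -row_rows_of row_sub.
Qed.

(** A largest independent subset spans all vectors of [X], as it could be enlarged otherwise. *)
Lemma rank_linear_matroid X : rank (linear_matroid c) X = \rank (rows_of X).
Proof.
apply/eqP; rewrite eqn_leq /rank; apply/andP; split.
  apply/bigmax_leqP=> Y /andP[sYX /row_free_rows_of /eqP <-].
  exact/mxrankS/rows_ofS.
pose D Y := (Y \subset X) && linear_indep c Y.
have D0 : D set0 by rewrite /D sub0set linear_indep0.
case: (arg_maxnP (fun Y => #|Y|) D0) => Y /andP[sYX iY] maxY.
apply: (@leq_trans #|Y|); last first.
  by apply: (leq_bigmax_cond (F := fun Y => #|Y|)); rewrite sYX.
rewrite -(eqP (row_free_rows_of iY)); apply/mxrankS/row_subP => i.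
rewrite row_rows_of; apply: rows_of_span; apply: contraT => nspan.
have xX : enum_val i \in X by apply: enum_valP.
have nY : enum_val i \notin Y.
  apply: contra nspan => h; apply: memv_span; apply: image_f.
  exact: h.
have := maxY (enum_val i |: Y); rewrite cardsU1 nY add1n /D subUset sub1set xX sYX /=.
rewrite ltnn; apply; rewrite /linear_indep /image_mem.
have /(perm_map c)/perm_free -> : perm_eq (enum (enum_val i |: Y)) (enum_val i :: enum Y).
  apply: uniq_perm; rewrite /= ?enum_uniq ?mem_enum ?nY //.
  by move=> x; rewrite inE !mem_enum !inE.
by rewrite /= free_cons nspan; exact: iY.
Qed.

End LinearMatroidRank.

(** * From the parity check matrix to forms vanishing on the complement *)

Section VeroneseNullity.
Variables (F : finFieldType) (n m : nat).
Variables (pt : 'I_n -> point F) (pos : point F -> 'I_n).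
Hypotheses (ptK : cancel pt pos) (posK : cancel pos pt).
Variable rep : point F -> 'rV[F]_3.
Hypothesis hrep : representatives rep.
Variable H : 'M[F]_(m, n).
Hypothesis hH : parity_check_matrix (veronese_generator pt rep) H.
Local Open Scope ring_scope.
Local Notation G := (veronese_generator pt rep).
Implicit Types (X Z : {set point F}) (p : point F) (v w : 'rV[F]_3).

Lemma in_point p v : (v \in val p) = [exists c : F, v == c *: rep p].
Proof.
have [pp p0] := hrep p; have /existsP[u /andP[u0 /eqP pE]] := valP p.
move: pp; rewrite pE => /imsetP[c _ rE].
have c0 : c != 0 by apply: contraNneq p0 => c0; rewrite rE c0 scale0r.
apply/imsetP/existsP => [[d _ ->]|[d /eqP ->]].
  by exists (d / c); rewrite rE scalerA divfK.
by exists (d * c); rewrite // rE scalerA.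
Qed.

Lemma rep_in p : rep p \in val p. Proof. by case: (hrep p). Qed.

Lemma representatives_coordinates : coordinates rep.
Proof.
have r0 p : rep p != 0 by case: (hrep p).
split=> // [p p' c e|v v0].
  have c0 : c != 0 by apply: contraNneq (r0 p') => c0; rewrite e c0 scale0r.
  apply/val_inj/setP=> v; rewrite !in_point e.
  apply/existsP/existsP => -[d /eqP->].
    by exists (d / c); rewrite scalerA divfK.
  by exists (d * c); rewrite scalerA.
have vP : is_point [set a *: v | a : F] by apply/existsP; exists v; rewrite v0 eqxx.
pose p : point F := Sub _ vP; exists p.
have := rep_in p; rewrite SubK => /imsetP[c _ e]; exists c; split=> //.
by apply: contraNneq (r0 p) => c0; rewrite e c0 scale0r.
Qed.

Lemma zeros_linp w : zeros (linp w) = line rep w.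
Proof.
apply/setP=> p; rewrite in_line !inE; apply/forall_inP/eqP => [/(_ _ (rep_in p))/eqP|e v].
  by rewrite meval_linp.
by rewrite in_point => /existsP[c /eqP->]; rewrite meval_linp dotZ e mulr0.
Qed.

Lemma zeros_quadp a : zeros (quadp a) = quadric rep a.
Proof.
apply/setP=> p; rewrite in_quadric !inE; apply/forall_inP/eqP => [/(_ _ (rep_in p))/eqP|e v].
  by rewrite meval_quadp.
by rewrite in_point => /existsP[c /eqP->]; rewrite meval_quadp evZr e mulr0.
Qed.

Lemma is_line_ln (L : {set point F}) : is_line L <-> is_ln rep L.
Proof.
split=> [[l [/homog1_linp[w ->] w0 ->]]|/is_lnP[w w0 ->]].
  by apply/is_lnP; exists w; rewrite ?zeros_linp // -linp_eq0.
by exists (linp w); rewrite linp_homog linp_eq0 zeros_linp.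
Qed.

(** Here q >= 4 enters: the q + 1 points of an irreducible conic pass the bound in [conic_set]. *)
Lemma irreducible_conic_set (q4 : (3 < #|F|)%N) Z :
  is_irreducible_conic Z <-> conic_set rep Z.
Proof.
have hc := representatives_coordinates.
split=> [[Q [/homog2_quadp[a ->] irr ->]]|/and3P[aZ Z5 /existsP[a /eqP ZE]]].
  have [ha hcard] := abs_irreducible_conic hc irr.
  by rewrite zeros_quadp /conic_set ha hcard ltnS q4; apply/existsP; exists a.
exists (quadp a); rewrite zeros_quadp quadp_homog; split=> //.
by apply: (conic_abs_irreducible hc); rewrite -ZE.
Qed.

Lemma mul_generator a j : (a *m G) 0 j = ev a (rep (pt j)).
Proof.
have -> : (a *m G) 0 j = (a *m vcol rep (pt j)) 0 0.
  by rewrite !mxE; apply: eq_bigr => i _; rewrite !mxE.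
by rewrite ev_vcol !mxE eqxx mulr1n.
Qed.

(** Unit vectors at the positions of [X]: they span the words supported in [X]. *)
Definition coord_rows X : 'M[F]_(#|X|, n) := \matrix_(i, j) (pos (enum_val i) == j)%:R.

Lemma sub_coord_rows X (u : 'rV[F]_n) :
  (u <= coord_rows X)%MS = [forall j, (pt j \notin X) ==> (u 0 j == 0)].
Proof.
apply/submxP/forall_inP => [[w ->] j jX|h].
  rewrite !mxE big1 // => i _; rewrite !mxE; case: eqP => [e|]; last by rewrite mulr0.
  by rewrite -e posK enum_valP in jX.
exists (\row_i u 0 (pos (enum_val i))); apply/rowP=> j; rewrite !mxE.
have [jX|jX] := boolP (pt j \in X); last first.
  rewrite (eqP (h _ jX)) big1 // => i _; rewrite !mxE.
  case: eqP => [e|_]; last by rewrite mulr0.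
  by rewrite -e posK enum_valP in jX.
rewrite (bigD1 (enum_rank_in jX (pt j))) //= big1 ?addr0.
  by rewrite !mxE enum_rankK_in // ptK eqxx mulr1.
move=> i ni; rewrite !mxE; case: eqP => [e|]; last by rewrite mulr0.
by case/eqP: ni; apply: enum_val_inj; rewrite enum_rankK_in // -e posK.
Qed.

Lemma rank_coord_rows X : \rank (coord_rows X) = #|X|.
Proof.
apply/eqP; rewrite -[_ == _]/(row_free _); apply/row_freeP.
exists (coord_rows X)^T; apply/matrixP=> i k; rewrite !mxE.
rewrite (bigD1 (pos (enum_val i))) //= !mxE eqxx mul1r big1 ?addr0.
  by rewrite (can_eq posK) (inj_eq enum_val_inj) eq_sym.
by move=> j; rewrite eq_sym => /negPf nj; rewrite !mxE nj mul0r.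
Qed.

(** The nullity is the dimension of the space of linear relations between the columns in [X], that
    is, of the codewords supported in [X]. A codeword lists the values of a form, so these are the
    forms vanishing off [X]; by [hdT] distinct forms give distinct codewords. *)
Lemma nullity_hd X : nullity (column_matroid H pos) X = hd rep (~: X).
Proof.
have hc := representatives_coordinates; have [fH kH] := hH.
have Gfree : row_free G.
  apply: inj_row_free => a e.
  have : (0 < hd rep setT)%N -> a = 0 by rewrite (hdT hc).
  have [->//|a0] := eqVneq a 0; apply; apply: (hd_gt0 a0).
  apply/subsetP => p _; rewrite in_quadric -[p]posK -mul_generator e mxE.
  exact: eqxx.
have eB : rows_of (fun p => col (pos p) H) X = coord_rows X *m H^T.
  apply/matrixP=> i j; rewrite !mxE (bigD1 (pos (enum_val i))) //= !mxE eqxx mul1r.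
  rewrite big1 ?addr0 // => k nk; rewrite !mxE eq_sym (negPf nk).
  by rewrite mul0r.
rewrite /nullity rank_linear_matroid eB -{1}(rank_coord_rows X).
rewrite -(mxrank_mul_ker (coord_rows X) H^T) addKn.
rewrite /hd -(mxrankMfree _ Gfree); apply/eqmx_rank/andP; split; apply/rV_subP => u.
  rewrite sub_capmx sub_coord_rows => /andP[/forall_inP h /sub_kermxP uH].
  have : (u <= G)%MS by apply/kH; rewrite -[H]trmxK -trmx_mul uH trmx0.
  case/submxP => a uE; rewrite uE submxMr // sub_forms_on.
  apply/subsetP=> p; rewrite in_setC in_quadric -[p]posK -mul_generator -uE => pX.
  exact: h.
case/submxP=> w; rewrite mulmxA; set a := w *m _ => uE.
have : (a <= forms_on rep (~: X))%MS by apply: submxMl.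
rewrite sub_forms_on => /subsetP sa; rewrite sub_capmx sub_coord_rows; apply/andP; split.
  apply/forall_inP => j jX; rewrite uE mul_generator -in_quadric sa //.
  by rewrite in_setC.
apply/sub_kermxP; apply: trmx_inj; rewrite trmx_mul trmxK trmx0; apply/kH.
by rewrite uE submxMl.
Qed.

(** If no form separates a point of [X] from the complement, removing it from [X] keeps the nullity,
    against minimality. The converse is [flat_eq]. *)
Lemma minimal_nullity_flat i X : minimal_nullity (column_matroid H pos) i X <->
  flat rep (~: X) /\ hd rep (~: X) = i.
Proof.
have nE Y : (Y \in nullity_class (column_matroid H pos) i) = (hd rep (~: Y) == i).
  by rewrite in_set nullity_hd.
split=> [/minsetP[]|[fX hX]].
  rewrite /= nE => /eqP hX minX; split=> // p; rewrite in_setC negbK => pX.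
  case: (pickP [pred a | (~: X \subset quadric rep a) && (p \notin quadric rep a)]).
    by move=> a /andP[sa pa]; exists a.
  move=> none; have /setP/(_ p) : X :\ p = X.
    apply: minX (subD1set _ _); rewrite /= nE -hX; apply/eqP/hd_closure => a.
    rewrite setCD setUC subUset sub1set; have := none a => /=.
    by case: (~: X \subset _) => /=; [move/negbFE -> | rewrite andbF].
  by rewrite !inE eqxx pX.
apply/minsetP; rewrite /= nE hX; split=> // Y; rewrite /= nE => /eqP hY sYX.
apply: setC_inj; apply: (flat_eq fX); first by rewrite setCS.
by rewrite hX hY.
Qed.

End VeroneseNullity.

(** * The shapes of the flats *)

Lemma has_card_setC (T : finType) (S : {set {set T}}) (Q : {set T} -> Prop) N :
  (forall Z, Z \in S <-> Q Z) -> #|S| = N -> has_card (fun X => Q (~: X)) N.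
Proof.
move=> SQ <-; exists [set ~: Z | Z in S]; last by rewrite card_imset //; apply: setC_inj.
move=> X; split=> [/imsetP[Z ZS ->]|/SQ h]; first by rewrite setCK; apply/SQ.
by apply/imsetP; exists (~: X); rewrite ?setCK.
Qed.

Section Shapes.
Variables (F : finFieldType) (rep : point F -> 'rV[F]_3).
Hypothesis hrep : representatives rep.
Implicit Types Z L : {set point F}.

Lemma line_pair_ln Z : is_line_pair Z <-> exists L L',
  [/\ is_ln rep L, is_ln rep L', L != L' & Z = L :|: L'].
Proof.
split=> -[L [L' [lL lL' /eqP n ->]]]; exists L, L'; split=> //;
  by [apply/(is_line_ln hrep) | apply/eqP].
Qed.

Lemma line_plus_point_ln Z : is_line_plus_point Z <-> exists L p,
  [/\ is_ln rep L, p \notin L & Z = p |: L].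
Proof.
split=> -[L [p [lL pL ->]]]; exists L, p; split=> //; exact/(is_line_ln hrep).
Qed.

Lemma collinear_ln Z :
  ~ collinear Z <-> forall L, is_ln rep L -> ~~ (Z \subset L).
Proof.
split=> [nZ L lL|h [L /(is_line_ln hrep) lL sZ]].
  by apply/negP=> sZ; apply: nZ; exists L; first exact/(is_line_ln hrep).
by have := h _ lL; rewrite sZ.
Qed.

Lemma quadrangle_arc Z : is_quadrangle Z <-> #|Z| = 4 /\ is_arc rep Z.
Proof.
split=> -[Z4 h]; split=> //.
  apply/(arc_collinear (representatives_coordinates hrep)) => T sT T3.
  exact/collinear_ln/h.
move=> T sT T3; apply/collinear_ln.
by move/(arc_collinear (representatives_coordinates hrep)): h; apply.
Qed.

Lemma triangle_arc Z : is_triangle Z <-> #|Z| = 3 /\ is_arc rep Z.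
Proof.
split=> -[Z3 h]; split=> //.
  apply/(arc_collinear (representatives_coordinates hrep)) => T sT T3.
  have -> : T = Z by apply/eqP; rewrite eqEcard sT T3 Z3.
  exact/collinear_ln.
apply/collinear_ln.
by move/(arc_collinear (representatives_coordinates hrep)): h; apply.
Qed.

End Shapes.

Lemma mul_eq_div d a b : 0 < d -> d * a = b -> a = b %/ d.
Proof. by move=> d0 <-; rewrite mulKn. Qed.

Theorem theorem3p4 (F : finFieldType) (q n m : nat)
    (hq : q = #|F|) (hq4 : 4 <= q)
    (pt : 'I_n -> point F) (pos : point F -> 'I_n)
    (ptK : cancel pt pos) (posK : cancel pos pt)
    (rep : point F -> 'rV[F]_3) (hrep : representatives rep)
    (H : 'M[F]_(m, n))
    (hH : parity_check_matrix (veronese_generator pt rep) H) :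
  let M := column_matroid H pos in
  [/\
   [/\ forall X : {set point F},
         minimal_nullity M 1 X <->
         is_line_pair (~: X) \/ is_irreducible_conic (~: X),
       has_card (fun X : {set point F} => is_line_pair (~: X))
         ((q * (q + 1) * (q ^ 2 + q + 1)) %/ 2)
     & has_card (fun X : {set point F} => is_irreducible_conic (~: X))
         (q ^ 5 - q ^ 2)],
   [/\ forall X : {set point F},
         minimal_nullity M 2 X <->
         is_line_plus_point (~: X) \/ is_quadrangle (~: X),
       has_card (fun X : {set point F} => is_line_plus_point (~: X))
         (q ^ 2 * (q ^ 2 + q + 1))
     & has_card (fun X : {set point F} => is_quadrangle (~: X))
         (((q ^ 2 + q + 1) * q ^ 2 * (q ^ 2 + q) * (q - 1) ^ 2) %/ 24)],
   [/\ forall X : {set point F},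
         minimal_nullity M 3 X <-> is_line (~: X) \/ is_triangle (~: X),
       has_card (fun X : {set point F} => is_line (~: X)) (q ^ 2 + q + 1)
     & has_card (fun X : {set point F} => is_triangle (~: X))
         (((q ^ 2 + q + 1) * q ^ 2 * (q ^ 2 + q)) %/ 6)],
   ((forall X : {set point F}, minimal_nullity M 4 X <-> #|~: X| = 2) /\
    has_card (fun X : {set point F} => #|~: X| = 2)
      (((q ^ 2 + q + 1) * (q ^ 2 + q)) %/ 2)) /\
   ((forall X : {set point F}, minimal_nullity M 5 X <-> #|~: X| = 1) /\
    has_card (fun X : {set point F} => #|~: X| = 1) (q ^ 2 + q + 1))
   & nullity_class M 6 = [set [set: point F]]].
Proof.
move=> M; have hc := representatives_coordinates hrep.
have q4 : 3 < #|F| by rewrite -hq.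
have minE := minimal_nullity_flat ptK posK hrep hH.
have c1 := card_arcs1 hc; have c2 := card_arcs2 hc.
have c3 := card_arcs3 hc; have c4 := card_arcs4 hc.
have arcsP' k Z : Z \in arcs rep k <-> #|Z| = k /\ is_arc rep Z.
  by split=> [/arcsP[]|[? ?]]; last exact/arcsP.
rewrite hq; split.
- split=> [X||].
  + apply: iff_trans (minE 1 X) _; apply: iff_trans (flat_hd1P hc (~: X)) _.
    by have := line_pair_ln hrep (~: X); have := irreducible_conic_set hrep q4 (~: X); tauto.
  + have [S hS cS] := card_line_pairs hc.
    by apply: has_card_setC cS => Z; have := hS Z; have := line_pair_ln hrep Z; tauto.
  + apply: has_card_setC (card_conics hc q4) => Z.
    by have := irreducible_conic_set hrep q4 Z; rewrite in_set; tauto.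
- split=> [X||].
  + apply: iff_trans (minE 2 X) _; apply: iff_trans (flat_hd2P hc (~: X)) _.
    by have := line_plus_point_ln hrep (~: X); have := quadrangle_arc hrep (~: X); tauto.
  + have [S hS cS] := card_line_points hc.
    by apply: has_card_setC cS => Z; have := hS Z; have := line_plus_point_ln hrep Z; tauto.
  + apply: (@has_card_setC _ (arcs rep 4)) => [Z|].
      by have := quadrangle_arc hrep Z; have := arcsP' 4 Z; tauto.
    apply: mul_eq_div => //; rewrite -c1.
    (* 24 = 4 . 3 . 2, one factor for each extension step, so the three recurrences apply in turn
       and the division is exact. *)
    have -> : 24 * #|arcs rep 4| = 6 * (4 * #|arcs rep 4|) by ring.
    rewrite c4; have -> (x y : nat) : 6 * (x * y) = 2 * (3 * x) * y by ring.
    rewrite c3; have -> (x y : nat) : 2 * (x * y) = (2 * x) * y by ring.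
    by rewrite c2; ring.
- split=> [X||].
  + apply: iff_trans (minE 3 X) _; apply: iff_trans (flat_hd3P hc (~: X)) _.
    by have := is_line_ln hrep (~: X); have := triangle_arc hrep (~: X); tauto.
  + apply: has_card_setC (card_lines hc) => Z.
    by have := is_line_ln hrep Z; rewrite in_set; tauto.
  + apply: (@has_card_setC _ (arcs rep 3)) => [Z|].
      by have := triangle_arc hrep Z; have := arcsP' 3 Z; tauto.
    apply: mul_eq_div => //; rewrite -c1.
    have -> : 6 * #|arcs rep 3| = 2 * (3 * #|arcs rep 3|) by ring.
    rewrite c3; have -> (x y : nat) : 2 * (x * y) = (2 * x) * y by ring.
    by rewrite c2; ring.
- split; split=> [X|].
  + exact: iff_trans (minE 4 X) (flat_hd_smallP hc (~: X) (k := 2) isT).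
  + apply: (@has_card_setC _ (arcs rep 2) (fun Z => #|Z| = 2)) => [Z|].
      apply: iff_trans (arcsP' 2 Z) _; split=> [[]|Z2] //; split=> //.
      by apply: small_arc; rewrite Z2.
    by apply: mul_eq_div => //; rewrite c2 c1.
  + exact: iff_trans (minE 5 X) (flat_hd_smallP hc (~: X) (k := 1) isT).
  + apply: (@has_card_setC _ (arcs rep 1) (fun Z => #|Z| = 1) _ _ c1) => Z.
    apply: iff_trans (arcsP' 1 Z) _; split=> [[]|Z1] //; split=> //.
    by apply: small_arc; rewrite Z1.
apply/setP=> X; rewrite in_set in_set1 (nullity_hd ptK posK hrep hH).
apply/eqP/eqP => [/(hd_eq6 hc) e|->]; first by rewrite -[X]setCK e setC0.
by rewrite setCT hd0.
Qed.
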